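(* Let $D_n\in\mathbb{N}$, $\rho_n\in(0,1]$, $\beta_n>0$, $N=N(n)$ be sequences such that $\gamma_n=n/N$ converges to a positive constant, let $\hat\lambda_n=\beta_n/\sqrt{\gamma_n}$, and consider the spiked Wishart model with spike prior $\mathcal{X}=\mathcal{X}_n^{\rho_n}$ (sparse Rademacher). Suppose $D_n=o(n)$. If one of the following holds for sufficiently large $n$: (a) $\limsup_{n\to\infty}\hat\lambda_n<1$ and $$\rho_n\ge \max\left(1,\sqrt{\frac{1}{6\log(1/\hat{\lambda}_n)}}\right)\sqrt{\frac{D_n}{n}},\quad\text{or}$$ (b) $\limsup_{n\to\infty}\hat\lambda_n<1/\sqrt3$ and $$\rho_n\ge \hat{\lambda}_n\sqrt{\frac{D_n}{n}},$$ then, as $n\to\infty$, $\|L_{n,N,\beta,\mathcal{X}}^{\le D_n}\| = O(1)$.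
   Context: Sparse Rademacher prior $\mathcal{X}_n^\rho$: the law on $\mathbb{R}^n$ of $x$ with i.i.d. entries equal to $+1/\sqrt{\rho n}$ with probability $\rho/2$, $-1/\sqrt{\rho n}$ with probability $\rho/2$, and $0$ with probability $1-\rho$. Spiked Wishart model with prior $\mathcal{X}$: under $\mathbb{P}_n$, first draw $x\sim\mathcal{X}$, then, given $x$, draw $N$ independent samples $y^{(1)},\dots,y^{(N)}\sim\mathcal{N}(0,I_n+\beta xx^\top)$; under $\mathbb{Q}_n$, draw $N$ independent samples from $\mathcal{N}(0,I_n)$. The data $(y^{(1)},\dots,y^{(N)})$ is viewed as a point of $\mathbb{R}^{nN}$. Low-degree likelihood ratio: let $L=d\mathbb{P}_n/d\mathbb{Q}_n$, and let $L^{\le D}=L_{n,N,\beta,\mathcal{X}}^{\le D}$ be its orthogonal projection, with respect to $\langle f,g\rangle=\mathbb{E}_{\mathbb{Q}_n}[fg]$, onto the space of polynomials of degree at most $D$ in the $nN$ data coordinates; i.e. $L^{\le D}$ is the unique polynomial of degree at most $D$ with $\mathbb{E}_{\mathbb{Q}_n}[L^{\le D}f]=\mathbb{E}_{\mathbb{P}_n}[f]$ for all polynomials $f$ of degree at most $D$. The norm is $\|f\|=\mathbb{E}_{\mathbb{Q}_n}[f^2]^{1/2}$. *)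

(* Defs.v *)
From HB Require Import structures.
From mathcomp Require Import all_boot all_order all_algebra.
(* Only the notations of mpoly conflict with those of the analysis library; the
   latter must come second, as both define a name Measure. *)
From mathcomp Require Import -(notations) mpoly.
From mathcomp Require Import all_classical all_reals all_analysis.
From mathcomp Require Import measurable_realfun ring.
Import Order.TTheory GRing.Theory Num.Theory.
Import numFieldNormedType.Exports.

Set Implicit Arguments.
Unset Strict Implicit.
Unset Printing Implicit Defensive.

Local Open Scope classical_set_scope.
Local Open Scope ring_scope.

Section product_law.
Context d (T : measurableType d) (R : realType).

Definition tuple_cons n (z : T * n.-tuple T) : n.+1.-tuple T :=
  [tuple of z.1 :: z.2].

Lemma measurable_tuple_cons n : measurable_fun [set: T * n.-tuple T] (@tuple_cons n).
Proof. exact: measurable_cons. Qed.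

HB.instance Definition _ n := isMeasurableFun.Build _ _ _ _
  (@tuple_cons n) (@measurable_tuple_cons n).

Fixpoint iid (P : probability T R) n : probability (n.-tuple T) R :=
  match n return probability (n.-tuple T) R with
  | 0 => \d_([tuple] : 0.-tuple T)
  | m.+1 => distribution (P \x iid P m)%E (@tuple_cons m)
  end.

End product_law.

Section gaussian.
Context (R : realType).

(* normal_prob lives on the generated sigma-algebra type measurableTypeR R;
   this identity transports it to the canonical Borel structure of R. *)
Definition borel_id : measurableTypeR R -> R := idfun.

HB.instance Definition _ :=
  isMeasurableFun.Build _ _ _ _ borel_id (@measurable_id _ _ setT).

Definition std_normal : probability R R :=
  distribution (normal_prob 0 1) borel_id.

Definition std_gaussian n : probability (n.-tuple R) R := iid std_normal n.

Definition lin_tuple n (A : 'M[R]_n) (z : n.-tuple R) : n.-tuple R :=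
  [tuple \sum_j A i j * tnth z j | i < n].

Lemma measurable_lin_tuple n (A : 'M[R]_n) :
  measurable_fun [set: n.-tuple R] (lin_tuple A).
Proof.
apply/measurable_fun_tnthP => i; rewrite /comp /=.
under eq_fun do rewrite tnth_mktuple.
apply: measurable_sum => j; apply: measurable_funM => //.
exact: measurable_tnth.
Qed.

HB.instance Definition _ n (A : 'M[R]_n) := isMeasurableFun.Build _ _ _ _
  (lin_tuple A) (measurable_lin_tuple A).

(* N(0, S) is the law of A z with z ~ N(0, I_n) and A A^T = S. That law does not
   depend on which such A is taken; if there is none (S is not positive
   semidefinite), cov_factor is 0. *)
Definition cov_factor n (S : 'M[R]_n) : 'M[R]_n :=
  xget 0 [set A : 'M[R]_n | A *m A^T = S].

Definition gaussian n (S : 'M[R]_n) : probability (n.-tuple R) R :=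
  distribution (std_gaussian n) (lin_tuple (cov_factor S)).

Definition spiked_cov n (beta : R) (x : 'cV[R]_n) : 'M[R]_n :=
  1%:M + beta *: (x *m x^T).

Lemma cov_factor_spiked n (beta : R) (x : 'cV[R]_n) : 0 <= beta ->
  cov_factor (spiked_cov beta x) *m (cov_factor (spiked_cov beta x))^T
  = spiked_cov beta x.
Proof.
move=> beta0; rewrite /cov_factor; case: xgetP => [A _ AS|noA]; [exact: AS|exfalso].
pose s : R := (x^T *m x) 0 0.
have sE : x^T *m x = s%:M by rewrite [LHS]mx11_scalar.
have s0 : 0 <= s.
  by rewrite /s mxE sumr_ge0// => i _; rewrite mxE -expr2 sqr_ge0.
have [sz|snz] := eqVneq s 0.
  have xz : x = 0.
    apply/matrixP => i j; rewrite ord1 mxE; apply/eqP; rewrite -sqrf_eq0.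
    move/eqP: sz; rewrite /s mxE psumr_eq0; last first.
      by move=> k _; rewrite mxE -expr2 sqr_ge0.
    by move=> /allP/(_ i (mem_index_enum i)); rewrite mxE -expr2.
  apply: (noA 1%:M); rewrite /= /spiked_cov xz mul0mx scaler0 addr0.
  by rewrite tr_scalar_mx mul1mx.
pose r := Num.sqrt (1 + beta * s).
have rE : r ^+ 2 = 1 + beta * s by rewrite sqr_sqrtr// addr_ge0// mulr_ge0.
pose c : R := (r - 1) / s.
apply: (noA (1%:M + c *: (x *m x^T))) => /=.
rewrite linearD/= tr_scalar_mx linearZ/= trmx_mul trmxK.
rewrite mulmxDl !mulmxDr !mul1mx mulmx1.
rewrite -scalemxAl -scalemxAr scalerA.
have -> : x *m x^T *m (x *m x^T) = s *: (x *m x^T).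
  by rewrite mulmxA -(mulmxA x) sE mul_mx_scalar -scalemxAl.
rewrite scalerA /spiked_cov -addrA -!scalerDl; congr (_ + _ *: _).
have -> : beta = (r ^+ 2 - 1) / s by rewrite rE addrAC subrr add0r mulfK.
by rewrite /c; field.
Qed.

End gaussian.

(* The law of a two-stage draw: i with probability w i, then a point of law P i. *)
Section mixture.
Context d (T : measurableType d) (R : realType) (I : finType).
Variables (w : I -> {nonneg R}) (P : I -> {measure set T -> \bar R}).
Local Open Scope ereal_scope.

Definition mixture (A : set T) : \bar R := \sum_(i : I) (w i)%:num%:E * P i A.

Let mixture0 : mixture set0 = 0.
Proof. by rewrite /mixture big1// => i _; rewrite measure0 mule0. Qed.

Let mixture_ge0 A : 0 <= mixture A.
Proof. by apply: sume_ge0 => i _; rewrite mule_ge0. Qed.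

Let mixture_sigma_additive : semi_sigma_additive mixture.
Proof.
move=> F mF tF mUF; rewrite [X in _ --> X](_ : _ =
    lim ((fun n => \sum_(0 <= i < n) mixture (F i)) @ \oo)).
  by apply: is_cvg_ereal_nneg_natsum => k _; exact: mixture_ge0.
rewrite nneseries_sum//; apply: eq_bigr => /= i _.
exact: (measure_semi_bigcup (mscale (w i) (P i))).
Qed.

HB.instance Definition _ := isMeasure.Build _ _ _ mixture
  mixture0 mixture_ge0 mixture_sigma_additive.

End mixture.

Section prior.
Context (R : realType) (rho : R) (n : nat).

(* The entries of the spike are coded by option bool: None is the value 0 and
   Some b is the value with sign (-1)^b. For rho outside [0, 1] the law is
   replaced by the point mass at 0, as for bernoulli_pmf. *)
Definition entry_pmf (e : option bool) : R :=
  if 0 <= rho <= 1 then (if e is Some _ then rho / 2 else 1 - rho)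
  else (e == None)%:R.

Definition entry_val (e : option bool) : R :=
  if e is Some b then (-1) ^+ b / Num.sqrt (rho * n%:R) else 0.

Lemma entry_pmf_ge0 e : 0 <= entry_pmf e.
Proof.
rewrite /entry_pmf; case: ifPn => [/andP[r0 r1]|_]; last exact: ler0n.
by case: e => [_|]; rewrite ?divr_ge0// subr_ge0.
Qed.

Lemma entry_pmf_sum : \sum_e entry_pmf e = 1.
Proof.
rewrite (bigD1 None)//= (bigD1 (Some true))//= (bigD1 (Some false))//=.
rewrite big1 ?addr0; last by case=> [[]|].
rewrite /entry_pmf; case: ifP => _ //=; last by rewrite !addr0.
by field.
Qed.

Definition spike_pmf (s : {ffun 'I_n -> option bool}) : R :=
  \prod_i entry_pmf (s i).

Definition spike_val (s : {ffun 'I_n -> option bool}) : 'cV[R]_n :=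
  \col_i entry_val (s i).

Lemma spike_pmf_ge0 s : 0 <= spike_pmf s.
Proof. by apply: prodr_ge0 => i _; exact: entry_pmf_ge0. Qed.

Lemma spike_pmf_sum : \sum_s spike_pmf s = 1.
Proof.
by rewrite -(bigA_distr_bigA (fun=> entry_pmf))/= big1// => i _; exact: entry_pmf_sum.
Qed.

Definition spike_weight s : {nonneg R} := NngNum (spike_pmf_ge0 s).

End prior.

Section wishart.
Context (R : realType) (n N : nat).

(* The data (y^(1), .., y^(N)) is an N-tuple of n-tuples: wishart_null is Q_n,
   wishart_spiked is P_n. *)
Definition wishart_null : probability (N.-tuple (n.-tuple R)) R :=
  iid (std_gaussian R n) N.

Definition wishart_given (beta : R) (x : 'cV[R]_n) :
    probability (N.-tuple (n.-tuple R)) R :=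
  iid (gaussian (spiked_cov beta x)) N.

Definition wishart_spiked (rho beta : R) : set (N.-tuple (n.-tuple R)) -> \bar R :=
  mixture (@spike_weight R rho n)
    (fun s => wishart_given beta (spike_val rho s)).

HB.instance Definition _ rho beta := Measure.on (wishart_spiked rho beta).

Let wishart_spiked_setT rho beta : wishart_spiked rho beta [set: _] = 1%E.
Proof.
rewrite /wishart_spiked /mixture.
rewrite (eq_bigr (fun s => (spike_pmf rho s)%:E)); last first.
  move=> s _; rewrite -[RHS]mule1; congr (_ * _)%E.
  exact: (probability_setT (wishart_given beta (spike_val rho s))).
by rewrite sumEFin spike_pmf_sum.
Qed.

HB.instance Definition _ rho beta :=
  Measure_isProbability.Build _ _ _ (wishart_spiked rho beta)
    (wishart_spiked_setT rho beta).

(* The variable of index mxvec_index i j is the j-th coordinate of the i-th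
   sample. *)
Definition data_coord (y : N.-tuple (n.-tuple R)) (k : 'I_(N * n)) : R :=
  mxvec (\matrix_(i < N, j < n) tnth (tnth y i) j) 0 k.

Definition peval (p : mpoly.mpoly (N * n) R) (y : N.-tuple (n.-tuple R)) : R :=
  mpoly.meval (data_coord y) p.

(* mpoly.msize is 1 + the total degree, and 0 for the zero polynomial. *)
Definition deg_le (D : nat) (p : mpoly.mpoly (N * n) R) : Prop :=
  (mpoly.msize p <= D.+1)%N.

(* L^{<= D}, the projection of L = dP/dQ to polynomials of degree at most D, is
   the p of degree at most D with <p, f> = E_Q[L f] = E_P[f] for all such f.
   This form does not require L to be square-integrable under Q. *)
Definition low_degree_lr (rho beta : R) (D : nat) (p : mpoly.mpoly (N * n) R) : Prop :=
  deg_le D p /\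
  forall f, deg_le D f ->
    (\int[wishart_null]_y (peval p y * peval f y)%:E
     = \int[wishart_spiked rho beta]_y (peval f y)%:E)%E.

Definition null_norm (p : mpoly.mpoly (N * n) R) : \bar R :=
  ('N[wishart_null]_2%:E [EFin \o peval p])%E.

End wishart.

(* Main.v *)
From HB Require Import structures.
Require Import Defs.
From mathcomp Require Import all_boot all_order all_algebra.
From mathcomp Require Import -(notations) mpoly.
From mathcomp Require Import all_classical all_reals all_analysis.
From mathcomp Require Import measurable_realfun ring lra zify.
Import Order.TTheory GRing.Theory Num.Theory.
Import numFieldNormedType.Exports.

Set Implicit Arguments.
Unset Strict Implicit.
Unset Printing Implicit Defensive.

Local Open Scope classical_set_scope.
Local Open Scope ring_scope.

(** Write $L$ for the projected likelihood ratio, $h_a$ for the product of the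
monic Hermite polynomials of degrees $a_{ij}$ in the coordinates $y^{(i)}_j$, and
$x, x'$ for two independent draws of the spike.

Under the null law the $h_a$ are orthogonal with squared norms $\prod a_{ij}!$, and
those of degree at most $D$ span the polynomials of degree at most $D$. Hence
$L = \sum_a (E_P[h_a] / a!) h_a$, it is unique, and
$\|L\|^2 = \sum_{|a| \le D} E_P[h_a]^2 / a!$
(lemmas [low_degree_lr_unique] and [Enull_hermite_lr_sqr]).

Given $x$, a sample is $A z$ with $z$ standard Gaussian and $A A^T = 1 + \beta x x^T$.
Gaussian integration by parts only sees $A A^T$, and shows that raising the degree of
$h_a$ in one coordinate multiplies by entries of $A A^T - 1 = \beta x x^T$. Solving the
recursion gives $E[h_a] = c_{|a|} x^a$ with $c_{2k} = \beta^k (2k-1)!!$ and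
$c_d = 0$ for odd $d$ ([linE_hermite]). Collecting the terms of a given degree and
using the Chu-Vandermonde identity, one finds
$\|L\|^2 = \sum_{2k \le D} \beta^{2k} ((N/2)(N/2+1)...(N/2+k-1) / k!)\,
E\langle x, x'\rangle^{2k}$ ([norm_formula]).

Put $m = n \rho^2$. The moment $E\langle x, x'\rangle^{2k}$ is
$(2k)! / (\rho n)^{2k}$ times the coefficient of $u^k$ in
$(1 + \rho^2 \sum_{j \ge 1} u^j / (2j)!)^n$. That coefficient is at most
$(m + k/6)^k / (2^k k!)$: adding one factor increases the bound at least as much as it
increases the coefficient, by convexity, $(2i+2)! \ge 2 \cdot 12^i\, i!$ and the
binomial theorem ([mbound_step], [coef_pow_entry_le]). Since $(2k)! \le 4^k k!^2$, the
$k$-th term of $\|L\|^2$ is at most $\theta^k$ with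
$\theta = \beta^2 (N + D) (m + D/12) / (\rho n)^2
        = \hat\lambda^2 (1 + D/N) (1 + D/(12 m))$ ([norm_term_le]).

Now $D/N \to 0$. Under the first condition $D/m \le 6 \log(1/\hat\lambda)
\le 6 (1/\hat\lambda - 1)$, so $\hat\lambda^2 (1 + D/(12 m)) \le \hat\lambda$; under the
second one $\hat\lambda^2 D/m \le 1$, so $\hat\lambda^2 (1 + D/(12 m)) \le 5/12$. In both
cases $\theta$ is eventually bounded away from 1, and the series is dominated by a
convergent geometric one. *)

(** * Integration against a density *)

Section density.
Context d (T : measurableType d) (R : realType).
Variables (mu nu : {measure set T -> \bar R}) (g : T -> R).
Hypothesis g0 : forall x, 0 <= g x.
Hypothesis mg : measurable_fun [set: T] g.
Hypothesis nuE : forall A, measurable A -> nu A = (\int[mu]_(x in A) (g x)%:E)%E.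
Local Open Scope ereal_scope.

Import HBNNSimple.

Let integral_indic_density E : measurable E ->
  \int[nu]_x (\1_E x)%:E = \int[mu]_x ((\1_E x)%:E * (g x)%:E).
Proof.
move=> mE; rewrite integral_indic//= setIT nuE// integral_mkcond.
apply: eq_integral => x _; rewrite patchE indicE.
by case: ifPn => xE; rewrite ?mul1e ?mul0e.
Qed.

Let integral_nnsfun_density (f : {nnsfun T >-> R}) :
  \int[nu]_x (f x)%:E = \int[mu]_x ((f x)%:E * (g x)%:E).
Proof.
under [LHS]eq_integral do rewrite fimfunE -fsumEFin//.
rewrite [LHS]ge0_integral_fsum//; last 2 first.
  - by move=> r; exact/measurable_EFinP/measurableT_comp.
  - by move=> n x _; rewrite EFinM nnfun_muleindic_ge0.
under [RHS]eq_integral.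
  move=> x xD; rewrite fimfunE -fsumEFin// ge0_mule_fsuml; last first.
    by move=> r; rewrite EFinM nnfun_muleindic_ge0.
  over.
rewrite [RHS]ge0_integral_fsum//; last 2 first.
  - move=> r; apply: emeasurable_funM; last exact/measurable_EFinP.
    by apply/measurable_EFinP/measurableT_comp.
  - move=> n x _; rewrite EFinM mule_ge0// ?lee_fin//.
    exact: nnfun_muleindic_ge0.
apply: eq_fsbigr => r /[!inE] -[t _ <-].
under [LHS]eq_integral do rewrite EFinM.
rewrite ge0_integralZl//; last 2 first.
  - exact/measurable_EFinP/measurable_indic.
  - by rewrite lee_fin.
rewrite integral_indic_density//.
rewrite -ge0_integralZl//; last 3 first.
  - by apply: emeasurable_funM; apply/measurable_EFinP => //; exact: measurable_indic.
  - by move=> x _; rewrite mule_ge0// lee_fin.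
  - by rewrite lee_fin.
by apply: eq_integral => x _; rewrite EFinM muleA.
Qed.

(** Integration against a measure with density [g]; the integrand is
nonnegative. *)
Lemma ge0_integral_density (f : T -> \bar R) :
  measurable_fun [set: T] f -> (forall x, 0 <= f x) ->
  \int[nu]_x f x = \int[mu]_x (f x * (g x)%:E).
Proof.
move=> mf f0; pose f_ := nnsfun_approx measurableT mf.
transitivity (lim (\int[nu]_x (f_ n x)%:E @[n --> \oo])).
  rewrite -monotone_convergence//=.
  - apply: eq_integral => ? /[!inE] xD; apply/esym/cvg_lim => //=.
    exact: cvg_nnsfun_approx.
  - by move=> n; exact/measurable_EFinP/measurable_funTS.
  - by move=> n ? _; rewrite lee_fin.
  - by move=> ? _ ? ? mn; rewrite lee_fin; exact/lefP/nd_nnsfun_approx.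
under eq_fun do rewrite integral_nnsfun_density.
rewrite -monotone_convergence//=.
- apply: eq_integral => x _; apply/cvg_lim => //=.
  rewrite muleC; under eq_fun do rewrite muleC.
  apply: cvgeZl => //; exact: (cvg_nnsfun_approx measurableT mf).
- move=> n; apply: emeasurable_funM; last exact/measurable_EFinP.
  exact/measurable_EFinP/measurable_funTS.
- by move=> n ? _; rewrite mule_ge0// lee_fin.
- move=> x _ ? ? mn; apply: lee_wpmul2r; first by rewrite lee_fin.
  by rewrite lee_fin; exact/lefP/nd_nnsfun_approx.
Qed.

Lemma integrable_density (f : T -> \bar R) : measurable_fun [set: T] f ->
  mu.-integrable [set: T] (fun x => f x * (g x)%:E) -> nu.-integrable [set: T] f.
Proof.
move=> mf /integrableP[_ fg]; apply/integrableP; split => //.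
rewrite ge0_integral_density//; last exact: measurableT_comp.
apply: le_lt_trans fg; apply: ge0_le_integral => //=.
- by move=> x _; rewrite mule_ge0// lee_fin.
- apply: emeasurable_funM; last exact/measurable_EFinP.
  exact: measurableT_comp.
- apply: measurableT_comp => //; apply: emeasurable_funM => //.
  exact/measurable_EFinP.
- by move=> x _; rewrite abseM [X in _ <= _ * X]gee0_abs// lee_fin.
Qed.

Lemma integral_density (f : T -> \bar R) : measurable_fun [set: T] f ->
  \int[nu]_x f x = \int[mu]_x (f x * (g x)%:E).
Proof.
move=> mf; rewrite [LHS]integralE [RHS]integralE.
rewrite !ge0_integral_density//;
  [|exact: measurable_funeneg|exact: measurable_funepos].
congr (_ - _); apply: eq_integral => x _.
  by rewrite !funeposE maxe_pMl ?mul0e// lee_fin.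
by rewrite !funenegE -mulNe maxe_pMl ?mul0e// lee_fin.
Qed.

End density.

(** * Moments of the standard normal law *)

Section normal_moments.
Variable R : realType.
Local Notation mu := (@lebesgue_measure R).
Local Notation phi := (normal_pdf (0 : R) 1).

Lemma std_normal_pdfE (x : R) : phi x = normal_peak 1 * expR (- x ^+ 2 / 2).
Proof. by rewrite normal_pdfE ?oner_neq0// /normal_fun subr0 expr1n. Qed.

Lemma sqrt2_neq0 : Num.sqrt 2 != 0 :> R.
Proof. by rewrite gt_eqF// sqrtr_gt0. Qed.

Lemma normal_pdf_sqrt2 (x : R) :
  normal_pdf 0 (Num.sqrt 2) x = normal_peak (Num.sqrt 2) * expR (- x ^+ 2 / 4).
Proof.
rewrite normal_pdfE ?sqrt2_neq0// /normal_fun subr0 sqr_sqrtr//.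
by rewrite (_ : 2 *+ 2 = 4)// -mulr_natr -natrM.
Qed.

Lemma normX_le_expR (k : nat) (x : R) :
  `|x ^+ k| <= (1 + 4 ^+ k * k`!%:R) * expR (x ^+ 2 / 4).
Proof.
have x4 : 0 <= x ^+ 2 / 4 by rewrite divr_ge0// sqr_ge0.
have e1 : 1 <= expR (x ^+ 2 / 4) by rewrite -[leLHS]expR0 ler_expR.
have h : `|x ^+ k| <= 1 + `|x ^+ k| ^+ 2.
  have := sqr_ge0 (1 - `|x ^+ k|); have := normr_ge0 (x ^+ k); nra.
apply: (le_trans h); rewrite mulrDl mul1r lerD//.
rewrite -normrX -exprM mulnC exprM ger0_norm; last by rewrite exprn_ge0// sqr_ge0.
case: k h => [|k] _; first by rewrite expr0 fact0 expr0 !mul1r.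
have h : (x ^+ 2 / 4) ^+ k.+1 / (k.+1)`!%:R <= expR (x ^+ 2 / 4).
  by apply: le_trans (expR_ge1Dxn k x4); rewrite lerDr.
have f0 : 0 < (k.+1)`!%:R :> R by rewrite ltr0n fact_gt0.
move: h; rewrite ler_pdivrMr// expr_div_n ler_pdivrMr ?exprn_gt0// => h.
by apply: (le_trans h); rewrite le_eqVlt; apply/orP; left; apply/eqP; ring.
Qed.

(** A Gaussian factor dominates every polynomial. *)
Lemma horner_le_expR (p : {poly R}) :
  exists C, forall x, `|p.[x]| <= C * expR (x ^+ 2 / 4).
Proof.
exists (\sum_(i < size p) `|p`_i| * (1 + 4 ^+ i * i`!%:R)) => x.
rewrite horner_coef mulr_suml (le_trans (ler_norm_sum _ _ _))// ler_sum// => i _.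
by rewrite normrM -mulrA ler_wpM2l// normX_le_expR.
Qed.

Lemma horner_phi_le (p : {poly R}) :
  exists2 C, 0 <= C & forall x, `|p.[x] * phi x| <= C * expR (- x ^+ 2 / 4).
Proof.
have [C pC] := horner_le_expR p.
have C0 : 0 <= C.
  by have := pC 0; rewrite expr0n/= mul0r expR0 mulr1; apply: le_trans.
exists (C * normal_peak 1) => [|x]; first by rewrite mulr_ge0// normal_peak_ge0.
rewrite normrM [`|phi x|]ger0_norm ?normal_pdf_ge0// std_normal_pdfE.
rewrite mulrCA -mulrA [leRHS]mulrCA ler_wpM2l ?normal_peak_ge0//.
have -> : - x ^+ 2 / 2 = - x ^+ 2 / 4 - x ^+ 2 / 4 by field.
rewrite expRD mulrCA [leRHS]mulrC ler_wpM2l ?expR_ge0//.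
by rewrite expRN ler_pdivrMr ?expR_gt0.
Qed.

Lemma integrable_horner_phi (p : {poly R}) :
  mu.-integrable [set: R] (fun x => (p.[x] * phi x)%:E).
Proof.
have [C C0 pC] := horner_phi_le p.
pose K := C / normal_peak (Num.sqrt 2).
have iK := integrableZl measurableT K (integrable_normal_pdf (0 : R) (Num.sqrt 2)).
apply: le_integrable iK => //.
- apply/measurable_EFinP; apply: measurable_funM.
    by apply: continuous_measurable_fun => x; exact: continuous_horner.
  exact: measurable_normal_pdf.
- move=> x _; rewrite -EFinM lee_fin (le_trans (pC x))//.
  rewrite (le_trans _ (ler_norm _))// /K normal_pdf_sqrt2 mulrA divfK//.
  by rewrite gt_eqF// normal_peak_gt0// sqrt2_neq0.
Qed.


Lemma derive_horner_phi (p : {poly R}) (x : R) :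
  is_derive x 1 (fun y => p.[y] * phi y) ((p^`() - 'X * p).[x] * phi x).
Proof.
have d1 : is_derive x 1 (fun y : R => - y ^+ 2 / 2) (- x).
  by apply: is_derive_eq; rewrite /GRing.scale/=; field.
have dphi : is_derive x 1 phi (- x * phi x).
  have -> : - x * phi x =
      normal_peak 1 *: (- x *: expR (- x ^+ 2 / 2)).
    by rewrite std_normal_pdfE /GRing.scale/= mulrCA.
  have -> : (phi : R -> R) = normal_peak 1 *: (expR \o (fun y => - y ^+ 2 / 2)).
    by apply/funext => y; rewrite std_normal_pdfE.
  by apply: is_derive_eq; congr (_ *: _); rewrite mulrC.
have dp : is_derive x 1 (horner p) p^`().[x].
  by apply: DeriveDef; [exact: derivable_horner|rewrite derivE derive1E].
have /= dM := @is_deriveM _ _ (horner p) phi x 1 _ _ dp dphi.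
rewrite (_ : _ * phi x = p.[x] *: (- x * phi x) + phi x *: p^`().[x]) //.
by rewrite hornerD hornerN hornerM hornerX /GRing.scale/=; ring.
Qed.

Lemma horner_phi_cvg0 (p : {poly R}) (u : nat -> R) :
  (forall n, u n ^+ 2 = n.+1%:R ^+ 2) ->
  (p.[u n] * phi (u n)) @[n --> \oo] --> 0.
Proof.
move=> un; have [C C0 pC] := horner_phi_le p.
apply: norm_cvg0; apply: (@squeeze_cvgr _ _ _ _ (cst 0) (fun n => C * 4 * harmonic n)).
- apply: nearW => n; rewrite normr_ge0/= (le_trans (pC _))// un -mulrA ler_wpM2l//.
  have h0 : 0 < 4 * harmonic n :> R by rewrite mulr_gt0// /harmonic invr_gt0.
  rewrite mulNr expRN invf_ple ?posrE ?expR_gt0//.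
  apply: le_trans (expR_ge1Dx _).
  rewrite /harmonic invfM invrK; have := sqr_ge0 (n.+1%:R - 2 : R); nra.
- exact: cvg_cst.
- by rewrite -[X in _ --> X](mulr0 (C * 4)); apply: cvgZl_tmp; exact: cvg_harmonic.
Qed.


(** The integrand is the derivative of [p phi], which vanishes at infinity. *)
Lemma integral_stein_phi (p : {poly R}) :
  (\int[mu]_x ((p^`() - 'X * p).[x] * phi x)%:E = 0)%E.
Proof.
set f := fun x => (p^`() - 'X * p).[x] * phi x.
have fi : mu.-integrable [set: R] (EFin \o f) by exact: integrable_horner_phi.
have mf : measurable_fun [set: measurableTypeR R] (EFin \o f).
  by case/integrableP: fi.
have cf : continuous f.
  move=> x; apply: continuousM; first exact: continuous_horner.
  exact/continuous_normal_pdf/oner_neq0.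
have cF : continuous (fun x => p.[x] * phi x).
  move=> x; apply: continuousM; first exact: continuous_horner.
  exact/continuous_normal_pdf/oner_neq0.
(* The integral over the real line is the limit of those over [-n-1, n+1]. *)
pose I n : set R := `[- n.+1%:R, n.+1%:R]%classic.
have intI n : (\int[mu]_(x in I n) (f x)%:E =
    (p.[n.+1%:R] * phi n.+1%:R)%:E - (p.[- n.+1%:R] * phi (- n.+1%:R))%:E)%E.
  apply: (@continuous_FTC2 _ f (fun x => p.[x] * phi x)).
  - by apply: lt_trans (ltr0Sn _ n); rewrite oppr_lt0.
  - exact: continuous_subspaceT.
  - split.
    + by move=> x _; have [] := derive_horner_phi p x.
    + exact/cvg_at_right_filter/cF.
    + exact/cvg_at_left_filter/cF.
  - by move=> x _; rewrite derive1E; have [_ ->] := derive_horner_phi p x.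
have cvg0 : (\int[mu]_(x in I n) (f x)%:E)%E @[n --> \oo] --> 0%E.
  under eq_fun do rewrite intI.
  have h : (p.[n.+1%:R] * phi n.+1%:R - p.[- n.+1%:R] * phi (- n.+1%:R))
      @[n --> \oo] --> (0 - 0 : R).
    by apply: cvgB; apply: horner_phi_cvg0 => n //; rewrite sqrrN.
  by rewrite subr0 in h; apply: cvg_EFin h; exact: nearW.
have mI n : measurable (I n) by exact: measurable_itv.
have := @dominated_convergence _ _ _ mu _ measurableT
  (fun n => (EFin \o f) \_ (I n)) (EFin \o f) (fun x => `|(f x)%:E|%E).
case.
- move=> n; apply/(measurable_restrictT _ (mI n)); apply: measurable_funTS.
  exact: mf.
- exact: mf.
- apply: aeW => x _; apply: cvg_near_cst.
  near=> n; rewrite patchE ifT// inE /I/= in_itv/= -ler_norml.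
  by rewrite (le_trans (ltW (truncnS_gt _)))// ler_nat ltnS; near: n; exists (Num.truncn `|x|).
- exact: integrable_abse.
- apply: aeW => x n _; rewrite patchE; case: ifPn => // _.
  by rewrite abse0 abse_ge0.
move=> _ _ cv; apply: (cvg_unique _ cv) => //.
apply: cvg_trans cvg0; apply: near_eq_cvg; apply: nearW => n /=; exact: integral_mkcond.
Unshelve. all: by end_near. Qed.

Let mphi : measurable_fun [set: measurableTypeR R] phi.
Proof. exact: measurable_normal_pdf. Qed.

Let phi_ge0 (x : measurableTypeR R) : 0 <= phi x.
Proof. exact: normal_pdf_ge0. Qed.

Lemma measurable_horner (p : {poly R}) : measurable_fun [set: R] (horner p).
Proof. by apply: continuous_measurable_fun => x; exact: continuous_horner. Qed.

Lemma integrable_std_normal (p : {poly R}) :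
  (std_normal R).-integrable [set: R] (fun x => p.[x]%:E).
Proof.
have mp : measurable_fun [set: R] (fun x => p.[x]%:E).
  by apply/measurable_EFinP; exact: measurable_horner.
apply: integrable_pushforward => //.
apply: (@integrable_density _ _ R mu (normal_prob 0 1) phi) => //.
exact: integrable_horner_phi.
Qed.

(** Gaussian integration by parts in one variable. *)
Lemma std_normal_stein (p : {poly R}) :
  \int[std_normal R]_x ('X * p).[x] = \int[std_normal R]_x p^`().[x].
Proof.
apply/esym/eqP; rewrite -subr_eq0 -RintegralB//; [|exact: integrable_std_normal..].
rewrite /Rintegral; apply/eqP.
under eq_integral do rewrite -hornerN -hornerD.
rewrite /std_normal integral_distribution//; last 2 first.
- by apply/measurable_EFinP; exact: measurable_horner.
- apply: (@integrable_density _ _ R mu (normal_prob 0 1) phi) => //.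
    by apply/measurable_EFinP; exact: measurable_horner.
  exact: integrable_horner_phi.
rewrite (@integral_density _ _ R mu (normal_prob 0 1) phi)//.
  by rewrite (_ : (\int[_]_x _)%E = 0%E)//; exact: integral_stein_phi.
by apply/measurable_EFinP; exact: measurable_horner.
Qed.

Lemma std_normal_cst (c : R) : \int[std_normal R]_x c%:P.[x] = c.
Proof.
rewrite /Rintegral; under eq_integral do rewrite hornerC.
by rewrite integral_cst//= [X in (_ * X)%E]probability_setT mule1.
Qed.

End normal_moments.

(** * Product laws *)

Section product.
Context d1 d2 (T1 : measurableType d1) (T2 : measurableType d2) (R : realType).
Variables (P : probability T1 R) (Q : probability T2 R).
Variables (F : T1 -> R) (G : T2 -> R).
Hypothesis iF : P.-integrable [set: T1] (EFin \o F).
Hypothesis iG : Q.-integrable [set: T2] (EFin \o G).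

Let mF : measurable_fun [set: T1] F.
Proof. by apply/measurable_EFinP; case/integrableP : iF. Qed.

Let mG : measurable_fun [set: T2] G.
Proof. by apply/measurable_EFinP; case/integrableP : iG. Qed.

Lemma integrable_prod :
  (P \x Q)%E.-integrable [set: T1 * T2] (fun z => (F z.1 * G z.2)%:E).
Proof.
apply/integrable12ltyP.
  by apply/measurable_EFinP; apply: measurable_funM; exact: measurableT_comp.
have aF : (\int[P]_x `|(F x)%:E| < +oo)%E by case/integrableP : iF.
have aG : (\int[Q]_y `|(G y)%:E| < +oo)%E by case/integrableP : iG.
under eq_integral => x _.
  under eq_integral do rewrite /= normrM EFinM.
  rewrite ge0_integralZl//; last first.
    by apply/measurable_EFinP; exact: measurableT_comp.
  over.
rewrite ge0_integralZr//; last 2 first.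
- by apply/measurable_EFinP; exact: measurableT_comp.
- exact: integral_ge0.
have fF := ge0_fin_numE (integral_ge0 _ (fun x _ => abse_ge0 (F x)%:E)).
apply: lte_mul_pinfty => //; first exact: integral_ge0.
by rewrite fF.
Qed.

Lemma integral_prod :
  \int[(P \x Q)%E]_z (F z.1 * G z.2) = (\int[P]_x F x) * (\int[Q]_y G y).
Proof.
rewrite {1}/Rintegral -integral12_prod_meas1; last exact: integrable_prod.
rewrite /fubini_F /=.
under eq_integral => x _.
  under eq_integral do rewrite EFinM.
  rewrite integralZl//.
  rewrite -[X in (_ * X)%E]fineK; last exact: integrable_fin_num.
  over.
rewrite integralZr//= -[X in fine (X * _)]fineK ?integrable_fin_num//.
Qed.

End product.

Section iid_product.
Context d (T : measurableType d) (R : realType) (P : probability T R).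

(** Under a product law, the expectation of a product of functions of the
separate coordinates is the product of the expectations. *)
Lemma iid_prod N (f : 'I_N -> T -> R) :
    (forall i, P.-integrable [set: T] (EFin \o f i)) ->
  (iid P N).-integrable [set: N.-tuple T] (fun y => (\prod_i f i (tnth y i))%:E) /\
  \int[iid P N]_y (\prod_i f i (tnth y i)) = \prod_i \int[P]_x f i x.
Proof.
elim: N f => [|N IH] f fi.
  rewrite big_ord0 /Rintegral; under eq_integral do rewrite big_ord0.
  under eq_fun do rewrite big_ord0.
  split; first exact: finite_measure_integrable_cst.
  by rewrite integral_cst// [X in (_ * X)%E]probability_setT mule1.
have [iN eN] := IH (fun i => f (lift ord0 i)) (fun i => fi _).
have consE : (fun y => (\prod_i f i (tnth y i))%:E) \o @tuple_cons _ T N =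
    (fun z => (f ord0 z.1 * \prod_i f (lift ord0 i) (tnth z.2 i))%:E).
  apply/funext => -[x y] /=; rewrite big_ord_recl; congr (_ * _)%:E.
  by apply: eq_bigr => i _; rewrite tnthS.
have mf : measurable_fun [set: N.+1.-tuple T] (fun y => (\prod_i f i (tnth y i))%:E).
  apply/measurable_EFinP; apply: measurable_prod => i _.
  apply: (@measurableT_comp _ _ _ _ _ _ (f i)); last exact: measurable_tnth.
  by apply/measurable_EFinP; case/integrableP : (fi i).
have ic : (P \x iid P N)%E.-integrable setT
    ((fun y => (\prod_i f i (tnth y i))%:E) \o @tuple_cons _ T N).
  by rewrite consE; exact: (integrable_prod (fi ord0) iN).
split; first exact: integrable_pushforward.
rewrite {1}/Rintegral [iid P N.+1]/= integral_distribution// consE.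
by rewrite big_ord_recl -eN -integral_prod.
Qed.

End iid_product.

(** * Expectations of polynomials in Gaussian variables *)

Section moment_functional.
Context d (T : measurableType d) (R : realType) (P : probability T R).
Variables (m : nat) (v : T -> 'I_m -> R).

(** The expectation of the polynomial [f] in the random variables [v _ i]. *)
Definition Epoly (f : mpoly m R) : R := \int[P]_y meval (v y) f.

Hypothesis iv : forall a : multinom m,
  P.-integrable [set: T] (fun y => (\prod_i v y i ^+ a i)%:E).

Lemma integrable_meval (f : mpoly m R) :
  P.-integrable [set: T] (fun y => (meval (v y) f)%:E).
Proof.
under eq_fun do rewrite mevalE -sumEFin.
apply: integrable_sum => // a _.
under eq_fun do rewrite EFinM.
exact: integrableZl.
Qed.

Lemma Epoly_linear : linear Epoly.
Proof.
move=> c f g; rewrite /Epoly /GRing.scale/=.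
rewrite -RintegralZl//; last exact: integrable_meval.
rewrite -RintegralD//; last 2 first.
- by under eq_fun do rewrite -mevalZ; exact: integrable_meval.
- exact: integrable_meval.
by apply: eq_Rintegral => y _; rewrite mevalD mevalZ.
Qed.

End moment_functional.

Section std_expectation.
Variable R : realType.

(** The expectation of a univariate polynomial of a standard normal variable. *)
Definition stdE (p : {poly R}) : R := \int[std_normal R]_x p.[x].

Lemma stdE_linear : linear stdE.
Proof.
move=> c p q; rewrite /stdE /GRing.scale/=.
rewrite -RintegralZl//; last exact: integrable_std_normal.
rewrite -RintegralD//; last 2 first.
- by under eq_fun do rewrite -hornerZ; exact: integrable_std_normal.
- exact: integrable_std_normal.
by apply: eq_Rintegral => y _; rewrite hornerD hornerZ.
Qed.

HB.instance Definition _ :=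
  GRing.isLinear.Build R {poly R} R _ stdE stdE_linear.

Lemma stdE_stein p : stdE ('X * p) = stdE p^`().
Proof. exact: std_normal_stein. Qed.

Lemma stdEC c : stdE c%:P = c. Proof. exact: std_normal_cst. Qed.

Lemma std_gaussian_prod n (p : 'I_n -> {poly R}) :
  (std_gaussian R n).-integrable [set: n.-tuple R]
     (fun z => (\prod_i (p i).[tnth z i])%:E) /\
  \int[std_gaussian R n]_z (\prod_i (p i).[tnth z i]) = \prod_i stdE (p i).
Proof. apply: (iid_prod (f := fun i x => (p i).[x])) => i; exact: integrable_std_normal. Qed.

Section gaussian_stein.
Variable n : nat.

(** The expectation of a polynomial in [n] independent standard normal variables. *)
Definition Egauss : mpoly n R -> R := Epoly (std_gaussian R n) (@tnth n R).

Lemma integrable_gauss_mon (a : multinom n) : (std_gaussian R n).-integrable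
  [set: n.-tuple R] (fun z => (\prod_i tnth z i ^+ a i)%:E).
Proof.
have [+ _] := std_gaussian_prod (fun i => 'X^(a i)).
by under eq_fun do under eq_bigr do rewrite hornerXn.
Qed.

HB.instance Definition _ := GRing.isLinear.Build R (mpoly n R) R _ Egauss
  (Epoly_linear integrable_gauss_mon).

Lemma EgaussX (a : multinom n) : Egauss (mpolyX R a) = \prod_i stdE 'X^(a i).
Proof.
have [_ <-] := std_gaussian_prod (fun i => 'X^(a i)).
apply: eq_Rintegral => z _; rewrite mevalX.
by apply: eq_bigr => i _; rewrite hornerXn.
Qed.

(** Gaussian integration by parts for polynomials in several variables. *)
Lemma gauss_stein (k : 'I_n) (f : mpoly n R) :
  Egauss (mpolyX R (mnm1 k) * f) = Egauss (mderiv k f).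
Proof.
elim/mpolyind: f => [|c a f _ _ IH]; first by rewrite mulr0 !raddf0.
rewrite mulrDr mderivD !linearD/= IH; congr (_ + _).
rewrite -scalerAr mderivZ !linearZ/=; congr (_ * _).
rewrite -mpolyXD mderivX linearZ/= !EgaussX.
rewrite [in LHS](bigD1 k)//= [in RHS](bigD1 k)//=.
rewrite mnmDE mnm1E eqxx add1n exprS stdE_stein derivXn raddfMn/=.
rewrite mnmBE mnm1E eqxx subn1 mulrnAl -[LHS]mulr_natl /GRing.scale/=; congr (_ * (_ * _)).
by apply: eq_bigr => i ik; rewrite mnmDE mnmBE mnm1E eq_sym (negbTE ik) add0n subn0.
Qed.

End gaussian_stein.

End std_expectation.

(** * Hermite polynomials in a linear image of a Gaussian vector *)

Section linear_forms.
Variables (R : realType) (n : nat).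
Implicit Types (l : mpoly n R) (q : {poly R}).

Lemma meval_horner_alg (v : 'I_n -> R) l q :
  meval v (horner_alg l q) = q.[meval v l].
Proof.
elim/poly_ind: q => [|q c IH]; first by rewrite !raddf0 horner0.
rewrite rmorphD rmorphM/= horner_algX horner_algC mevalD mevalM IH.
by rewrite hornerD hornerM hornerX hornerC mevalZ meval1 mulr1.
Qed.

Lemma mderiv_horner_alg (i : 'I_n) l q :
  mderiv i (horner_alg l q) = horner_alg l q^`() * mderiv i l.
Proof.
elim/poly_ind: q => [|q c IH]; first by rewrite deriv0 !raddf0 mul0r.
rewrite derivD derivM derivX derivC addr0 mulr1.
rewrite !rmorphD !rmorphM/= horner_algX horner_algC mderivD mderivM IH.
rewrite mderivZ mderivC scaler0 addr0 mulrDl; congr (_ + _).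
by rewrite mulrAC.
Qed.

Lemma mderiv_prod (i : 'I_n) m (F : 'I_m -> mpoly n R) :
  mderiv i (\prod_j F j) =
  \sum_k \prod_j (if j == k then mderiv i (F j) else F j).
Proof.
elim: m F => [|m IH] F; first by rewrite !big_ord0 mderivC.
rewrite big_ord_recl mderivM IH big_ord_recl; congr (_ + _).
  by rewrite big_ord_recl eqxx.
rewrite mulr_sumr; apply: eq_bigr => k _; rewrite big_ord_recl /=.
by congr (_ * _); apply: eq_bigr => j _; rewrite (inj_eq lift_inj).
Qed.

(** The [j]-th coordinate of [A z], as a linear form in [z]. *)
Definition lin_form (A : 'M[R]_n) (j : 'I_n) : mpoly n R :=
  \sum_p A j p *: mpolyX R (mnm1 p).

Lemma meval_lin_form (A : 'M[R]_n) j (z : n.-tuple R) :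
  meval (tnth z) (lin_form A j) = tnth (lin_tuple A z) j.
Proof.
rewrite tnth_mktuple raddf_sum; apply: eq_bigr => p _ /=.
by rewrite mevalZ mevalXU.
Qed.

Lemma mderiv_lin_form (A : 'M[R]_n) j p : mderiv p (lin_form A j) = (A j p)%:A.
Proof.
rewrite raddf_sum/= (bigD1 p)//= big1 ?addr0 => [|q qp]; last first.
  by rewrite mderivZ mderivX mnm1E (negbTE qp) scale0r scaler0.
rewrite mderivZ mderivX mnm1E eqxx scale1r; congr (_ *: _).
rewrite -[RHS]mpolyX0; congr mpolyX; apply/mnmP => q.
by rewrite mnmBE mnm0E subnn.
Qed.

End linear_forms.

Section hermite.
Variable R : realType.

(** The monic Hermite polynomials, orthogonal for the standard normal law. *)
Fixpoint hermite (d : nat) : {poly R} :=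
  if d is e.+1 then 'X * hermite e - (hermite e)^`() else 1.

Lemma hermiteS d : hermite d.+1 = 'X * hermite d - (hermite d)^`().
Proof. by []. Qed.

Lemma deriv_hermite d : (hermite d)^`() = d%:R *: hermite d.-1.
Proof.
elim: d => [|d IH]; first by rewrite /= derivC scale0r.
rewrite hermiteS derivB derivM derivX mul1r IH derivZ -scalerAr.
case: d IH => [|d] IH; first by rewrite /= !scale0r addr0 subr0 scale1r.
rewrite [d.+1.-1]/= [d.+2.-1]/= [in RHS]mulrS scalerDl scale1r -addrA; congr (_ + _).
by rewrite -scalerBr -hermiteS.
Qed.

Lemma stdE_hermite a b : stdE (hermite a * hermite b) = (a == b)%:R * (a`!)%:R.
Proof.
elim: a b => [|a IH] b.
  case: b => [|b]; first by rewrite /= mul1r -[1]/(1%:P) stdEC mul1r.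
  by rewrite mul1r hermiteS raddfB/= stdE_stein subrr mul0r.
rewrite hermiteS mulrBl raddfB/= -mulrA stdE_stein derivM raddfD/=.
rewrite addrAC subrr add0r deriv_hermite -scalerAr linearZ/= IH.
case: b => [|b]; first by rewrite scale0r mul0r.
rewrite eqSS /= /GRing.scale/=; have [->|] := eqVneq a b; rewrite ?mul0r ?mulr0// !mul1r.
by rewrite factS natrM.
Qed.

End hermite.

Section linear_image.
Variables (R : realType) (n : nat) (A : 'M[R]_n).

(** The expectation of the product of the [p j] in the coordinates of [A z], for [z] a
standard Gaussian vector. *)
Definition linE (p : 'I_n -> {poly R}) : R :=
  Egauss (\prod_j horner_alg (lin_form A j) (p j)).

(** Integration by parts for [A z]: only the covariance [A A^T] enters. *)
Lemma linE_stein (k : 'I_n) (p : 'I_n -> {poly R}) :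
  Egauss (lin_form A k * \prod_j horner_alg (lin_form A j) (p j)) =
  \sum_l (A *m A^T) k l * linE (fun j => if j == l then (p j)^`() else p j).
Proof.
rewrite {1}/lin_form mulr_suml raddf_sum /=.
under eq_bigr => i _.
  rewrite -scalerAl linearZ/= gauss_stein mderiv_prod raddf_sum /=.
  under eq_bigr => l _.
    rewrite (_ : \prod_j _ = A l i *: \prod_j horner_alg (lin_form A j)
        (if j == l then (p j)^`() else p j)); last first.
      rewrite (bigD1 l)//= [in RHS](bigD1 l)//= eqxx.
      rewrite mderiv_horner_alg mderiv_lin_form -scalerAr mulr1 -scalerAl.
      congr (_ *: (_ * _)); apply: eq_bigr => j jl.
      by rewrite (negbTE jl).
    rewrite linearZ/=.
    over.
  rewrite /GRing.scale/= mulr_sumr.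
  over.
rewrite exchange_big; apply: eq_bigr => l _ /=.
rewrite mxE mulr_suml; apply: eq_bigr => i _.
by rewrite mxE mulrA.
Qed.

End linear_image.

Section spiked_sample.
Variables (R : realType) (n : nat) (beta : R) (x : 'cV[R]_n).

(** [cmom d] is [beta^(d/2)] times the [d]-th moment of the standard normal law; it
is 0 for odd [d]. *)
Fixpoint cmom (d : nat) : R :=
  if d is e.+1 then (if e is d'.+1 then beta * e%:R * cmom d' else 0) else 1.

Lemma cmomSS d : cmom d.+2 = beta * d.+1%:R * cmom d.
Proof. by []. Qed.

Variable A : 'M[R]_n.
Hypothesis AA : A *m A^T = spiked_cov beta x.

Let H (a : 'I_n -> nat) := linE A (fun j => hermite R (a j)).

(* As [hermite d.+1 = 'X * hermite d - (hermite d)^`()], integration by parts leaves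
   the entries of [A A^T - 1 = beta x x^T]. *)
Let hermite_step (a : 'I_n -> nat) (k : 'I_n) :
  H (fun j => a j + (j == k))%N =
  beta * x k 0 * \sum_l x l 0 * (a l)%:R * H (fun j => a j - (j == l))%N.
Proof.
have -> : H (fun j => a j + (j == k))%N =
    Egauss (lin_form A k * \prod_j horner_alg (lin_form A j) (hermite R (a j)))
    - linE A (fun j => if j == k then (hermite R (a j))^`() else hermite R (a j)).
  rewrite -raddfB/= /H /linE; congr Egauss.
  rewrite [in LHS](bigD1 k)//= [X in _ = _ * X - _](bigD1 k)//= [X in _ = _ - X](bigD1 k)//=.
  rewrite eqxx addn1 hermiteS.
  rewrite raddfB/= rmorphM/= horner_algX mulrBl mulrA.
  congr (_ * _ - _ * _); apply: eq_bigr => j jk; rewrite (negbTE jk) ?addn0//.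
rewrite linE_stein AA.
have D l : linE A (fun j => if j == l then (hermite R (a j))^`() else hermite R (a j)) =
    (a l)%:R * H (fun j => a j - (j == l))%N.
  rewrite /H /linE -[RHS]linearZ/=; congr Egauss.
  rewrite (bigD1 l)//= [in RHS](bigD1 l)//= eqxx subn1 deriv_hermite linearZ/=.
  rewrite scalerAl; congr (_ * _); first by rewrite mulr_algl.
  apply: eq_bigr => j jl.
  by rewrite (negbTE jl) subn0.
under eq_bigr do rewrite D.
rewrite D (bigD1 k)//= /spiked_cov mxE mxE eqxx mulrDl mul1r.
have R3 (u v w : R) : u + v + w - u = v + w by ring.
rewrite R3 mulr_sumr [in RHS](bigD1 k)//=.
rewrite !mxE big_ord1 !mxE; congr (_ + _); first by rewrite -!mulrA.
apply: eq_bigr => l lk.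
rewrite !mxE big_ord1 !mxE eq_sym (negbTE lk) add0r.
by rewrite !mulrA.
Qed.

(** The expectation of a product of Hermite polynomials under N(0, 1 + beta x x^T),
by induction on the total degree. *)
Lemma linE_hermite (a : 'I_n -> nat) :
  linE A (fun j => hermite R (a j)) =
  cmom (\sum_j a j)%N * \prod_j x j 0 ^+ a j.
Proof.
rewrite -/(H a); have [m] := ubnP (\sum_j a j)%N.
elim: m a => // m IH a am.
have [a0|/forallPn[k ak]] := boolP [forall j, a j == 0%N].
  have {}a0 j : a j = 0%N by apply/eqP; exact: (forallP a0).
  rewrite /H /linE !big1 ?mulr1 => [|j _|j _|j _]; rewrite ?a0//; last exact: rmorph1.
  rewrite -[1]mpolyX0 EgaussX big1// => i _.
  by rewrite mnm0E expr0 -[1]/(1%:P) stdEC.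
pose b j := (a j - (j == k))%N.
have ab : a = (fun j => b j + (j == k))%N.
  by apply/funext => j; rewrite /b subnK//; have [->|//] := eqVneq j k; rewrite lt0n.
have sa : (\sum_j a j = (\sum_j b j).+1)%N.
  rewrite ab big_split/= -addn1; congr (_ + _)%N.
  by rewrite (bigD1 k)//= eqxx big1 ?addn0// => j /negbTE->.
have pa : \prod_j x j 0 ^+ a j = x k 0 * \prod_j x j 0 ^+ b j.
  rewrite (bigD1 k)//= [in RHS](bigD1 k)//= mulrA -exprS; congr (_ * _).
    by rewrite ab eqxx addn1.
  by apply: eq_bigr => j jk; rewrite ab (negbTE jk) addn0.
rewrite {1}ab (hermite_step b k) sa pa.
have E l : x l 0 * (b l)%:R * H (fun j => b j - (j == l))%N =
    (b l)%:R * (cmom (\sum_j b j).-1 * \prod_j x j 0 ^+ b j).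
  have [bl0|bl0] := eqVneq (b l) 0%N; first by rewrite bl0 mulr0 !mul0r.
  have bE j : ((b j - (j == l)) + (j == l))%N = b j.
    by rewrite subnK//; have [->|//] := eqVneq j l; rewrite lt0n.
  have sb : (\sum_j b j = (\sum_j (b j - (j == l))).+1)%N.
    under eq_bigr do rewrite -bE.
    rewrite big_split/= -addn1; congr (_ + _)%N.
    by rewrite (bigD1 l)//= eqxx big1 ?addn0// => j /negbTE->.
  rewrite IH; last by move: am; rewrite sa sb ltnS => /ltnW.
  rewrite sb/= [x l 0 * _]mulrC -mulrA; congr (_ * _).
  rewrite mulrCA; congr (_ * _).
  rewrite (bigD1 l)//= [in RHS](bigD1 l)//= mulrA -exprS eqxx; congr (_ * _).
    by rewrite subn1 prednK// lt0n.
  by apply: eq_bigr => j jl; rewrite (negbTE jl) subn0.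
rewrite (eq_bigr _ (fun l _ => E l)).
rewrite -mulr_suml -natr_sum.
case: (\sum_j b j)%N => [|s]; first by rewrite /= !mul0r mulr0.
by rewrite cmomSS/=; ring.
Qed.

End spiked_sample.

(** * Expectations under the null and the spiked law *)

Section mixture_integral.
Context d (T : measurableType d) (R : realType) (I : finType).
Variables (w : I -> {nonneg R}) (P : I -> {measure set T -> \bar R}).
Local Open Scope ereal_scope.

(* The components of the mixture, enumerated so that the mixture is a finite sum of
   a sequence of measures. *)
Let M (k : nat) : {measure set T -> \bar R} :=
  if insub k is Some i then mscale (w (@enum_val I xpredT i)) (P (enum_val i)) else mzero.

Lemma ge0_integral_mixture (f : T -> \bar R) :
  measurable_fun [set: T] f -> (forall y, 0 <= f y) ->
  \int[mixture w P]_y f y = \sum_i (w i)%:num%:E * \int[P i]_y f y.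
Proof.
move=> mf f0.
have -> : \int[mixture w P]_y f y = \int[msum M #|I|]_y f y.
  apply: eq_measure_integral => /= A mA _; rewrite /mixture /msum.
  rewrite (reindex_onto enum_val enum_rank) => [|i _]; last exact: enum_rankK.
  rewrite (eq_bigl xpredT) => [|i]; last by rewrite enum_valK eqxx.
  by apply: eq_bigr => i _; rewrite /M valK.
rewrite ge0_integral_measure_sum//.
rewrite [RHS](reindex_onto enum_val enum_rank) => [|i _]; last exact: enum_rankK.
rewrite [RHS](eq_bigl xpredT) => [|i]; last by rewrite enum_valK eqxx.
by apply: eq_bigr => i _; rewrite /M valK ge0_integral_mscale.
Qed.

Lemma integral_mixture (f : T -> \bar R) :
  (forall i, (P i).-integrable [set: T] f) -> measurable_fun [set: T] f ->
  (mixture w P).-integrable [set: T] f /\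
  \int[mixture w P]_y f y = \sum_i (w i)%:num%:E * \int[P i]_y f y.
Proof.
move=> fi mf; split.
  apply/integrableP; split => //.
  rewrite ge0_integral_mixture//; last exact: measurableT_comp.
  apply: lte_sum_pinfty => i _; apply: lte_mul_pinfty => //.
  by case/integrableP: (fi i).
rewrite integralE !ge0_integral_mixture//;
  [|exact: measurable_funeneg|exact: measurable_funepos].
rewrite -sumeN; last first.
  move=> i j _ _; apply: fin_num_adde_defl.
  by rewrite fin_numM// integrable_fin_num//; exact: integrable_funeneg.
rewrite -big_split/=; apply: eq_bigr => i _.
by rewrite (integralE (P i) setT f) [RHS]muleBr ?(integrable_add_def measurableT (fi i)).
Qed.

End mixture_integral.

Section data_polynomials.
Variables (R : realType) (N n : nat).
Implicit Type p : 'I_N -> 'I_n -> {poly R}.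

Lemma big_mxvec_index (F : 'I_(N * n) -> R) :
  \prod_k F k = \prod_i \prod_j F (mxvec_index i j).
Proof.
rewrite (reindex _ (curry_mxvec_bij N n))/= pair_bigA/=.
by apply: eq_bigr => -[].
Qed.

Lemma data_coordE (y : N.-tuple (n.-tuple R)) i j :
  data_coord y (mxvec_index i j) = tnth (tnth y i) j.
Proof. by rewrite /data_coord mxvecE mxE. Qed.

(** The polynomial in the data which is the product over [i, j] of the univariate
polynomial [p i j] in the [j]-th coordinate of the [i]-th sample. *)
Definition dpoly p : mpoly (N * n) R :=
  \prod_i \prod_j horner_alg (mpolyX R (mnm1 (mxvec_index i j))) (p i j).

Lemma peval_dpoly p y : peval (dpoly p) y = \prod_i \prod_j (p i j).[tnth (tnth y i) j].
Proof.
rewrite /peval rmorph_prod; apply: eq_bigr => i _.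
rewrite rmorph_prod; apply: eq_bigr => j _.
by rewrite /= meval_horner_alg mevalXU data_coordE.
Qed.

Lemma data_monomial (a : multinom (N * n)) (y : N.-tuple (n.-tuple R)) :
  \prod_k data_coord y k ^+ a k = peval (dpoly (fun i j => 'X^(a (mxvec_index i j)))) y.
Proof.
rewrite peval_dpoly big_mxvec_index; apply: eq_bigr => i _; apply: eq_bigr => j _.
by rewrite hornerXn data_coordE.
Qed.

Lemma null_dpoly p :
  (wishart_null R n N).-integrable [set: _] (fun y => (peval (dpoly p) y)%:E) /\
  \int[wishart_null R n N]_y peval (dpoly p) y = \prod_i \prod_j stdE (p i j).
Proof.
have := iid_prod (P := std_gaussian R n) (f := fun i z => \prod_j (p i j).[tnth z j]).
move=> /(_ (fun i => (std_gaussian_prod (p i)).1)) [iN eN].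
split; first by under eq_fun do rewrite peval_dpoly.
under eq_Rintegral do rewrite peval_dpoly.
rewrite eN.
by apply: eq_bigr => i _; have [_ ->] := std_gaussian_prod (p i).
Qed.

Lemma gaussian_prod (S : 'M[R]_n) (p : 'I_n -> {poly R}) :
  (gaussian S).-integrable [set: n.-tuple R]
    (fun z => (\prod_j (p j).[tnth z j])%:E) /\
  \int[gaussian S]_z (\prod_j (p j).[tnth z j]) = linE (cov_factor S) p.
Proof.
set A := cov_factor S.
have E : (fun z => (\prod_j (p j).[tnth z j])%:E) \o lin_tuple A =
    (fun z => (meval (tnth z) (\prod_j horner_alg (lin_form A j) (p j)))%:E).
  apply/funext => z /=; rewrite rmorph_prod; congr EFin; apply: eq_bigr => j _.
  by rewrite /= meval_horner_alg meval_lin_form.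
have mf : measurable_fun [set: n.-tuple R] (fun z => (\prod_j (p j).[tnth z j])%:E).
  apply/measurable_EFinP; apply: measurable_prod => i _.
  apply: (@measurableT_comp _ _ _ _ _ _ (horner (p i))).
    exact: measurable_horner.
  exact: measurable_tnth.
have iE : (std_gaussian R n).-integrable setT
    ((fun z => (\prod_j (p j).[tnth z j])%:E) \o lin_tuple A).
  by rewrite E; exact: (integrable_meval (@integrable_gauss_mon _ _)).
split; first by apply: (integrable_pushforward (measurable_lin_tuple A)).
by rewrite {1}/Rintegral integral_distribution// E.
Qed.

Lemma given_dpoly beta x p :
  (wishart_given N beta x).-integrable [set: _] (fun y => (peval (dpoly p) y)%:E) /\
  \int[wishart_given N beta x]_y peval (dpoly p) y =
    \prod_i linE (cov_factor (spiked_cov beta x)) (p i).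
Proof.
have := iid_prod (P := gaussian (spiked_cov beta x))
  (f := fun i z => \prod_j (p i j).[tnth z j]).
move=> /(_ (fun i => (gaussian_prod _ (p i)).1)) [iN eN].
split; first by under eq_fun do rewrite peval_dpoly.
under eq_Rintegral do rewrite peval_dpoly.
rewrite eN.
by apply: eq_bigr => i _; have [_ ->] := gaussian_prod (spiked_cov beta x) (p i).
Qed.

Lemma spiked_dpoly rho beta p :
  (@wishart_spiked R n N rho beta).-integrable [set: _] (fun y => (peval (dpoly p) y)%:E) /\
  \int[(@wishart_spiked R n N rho beta)]_y peval (dpoly p) y =
    \sum_s spike_pmf rho s *
      \prod_i linE (cov_factor (spiked_cov beta (spike_val rho s))) (p i).
Proof.
have := @integral_mixture _ _ _ _ (@spike_weight R rho n)
  (fun s => wishart_given N beta (spike_val rho s))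
  (fun y => (peval (dpoly p) y)%:E) (fun s => (given_dpoly beta _ p).1).
case.
  have [/integrableP[+ _] _] := null_dpoly p; exact.
move=> iS eS; split; first exact: iS.
rewrite /Rintegral eS -[RHS]/(fine (_%:E)) -sumEFin; congr fine.
apply: eq_bigr => s _; rewrite EFinM; congr (_ * _)%E.
have [i1 <-] := given_dpoly beta (spike_val rho s) p.
by rewrite /Rintegral fineK// integrable_fin_num.
Qed.

(** The expectations of a polynomial in the data under the null law and under the
spiked law. *)
Definition Enull : mpoly (N * n) R -> R :=
  Epoly (wishart_null R n N) (@data_coord R n N).

Definition Espiked rho beta : mpoly (N * n) R -> R :=
  Epoly (@wishart_spiked R n N rho beta) (@data_coord R n N).

Lemma null_mon (a : multinom (N * n)) : (wishart_null R n N).-integrable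
  [set: _] (fun y => (\prod_k data_coord y k ^+ a k)%:E).
Proof.
under eq_fun do rewrite data_monomial.
exact: (null_dpoly _).1.
Qed.

Lemma spiked_mon rho beta (a : multinom (N * n)) :
  (@wishart_spiked R n N rho beta).-integrable
  [set: _] (fun y => (\prod_k data_coord y k ^+ a k)%:E).
Proof.
under eq_fun do rewrite data_monomial.
exact: (spiked_dpoly _ _ _).1.
Qed.

HB.instance Definition _ := GRing.isLinear.Build R (mpoly (N * n) R) R _ Enull
  (Epoly_linear null_mon).

HB.instance Definition _ rho beta :=
  GRing.isLinear.Build R (mpoly (N * n) R) R _ (Espiked rho beta)
  (Epoly_linear (spiked_mon rho beta)).

Lemma integral_null f :
  (\int[wishart_null R n N]_y (peval f y)%:E = (Enull f)%:E)%E.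
Proof.
by rewrite /Enull /Epoly /Rintegral fineK// integrable_fin_num//;
  exact: (integrable_meval null_mon).
Qed.

Lemma integral_spiked rho beta f :
  (\int[(@wishart_spiked R n N rho beta)]_y (peval f y)%:E = (Espiked rho beta f)%:E)%E.
Proof.
by rewrite /Espiked /Epoly /Rintegral fineK// integrable_fin_num//;
  exact: (integrable_meval (spiked_mon rho beta)).
Qed.

Lemma EnullE p : Enull (dpoly p) = \prod_i \prod_j stdE (p i j).
Proof. exact: (null_dpoly p).2. Qed.

(** The multivariate Hermite polynomial of multi-index [a]. *)
Definition hermite_poly (a : 'I_N -> 'I_n -> nat) : mpoly (N * n) R :=
  dpoly (fun i j => hermite R (a i j)).

Lemma Enull_hermite (a b : 'I_N -> 'I_n -> nat) :
  Enull (hermite_poly a * hermite_poly b) =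
  [forall i, forall j, a i j == b i j]%:R * \prod_i \prod_j ((a i j)`!)%:R.
Proof.
have -> : hermite_poly a * hermite_poly b =
    dpoly (fun i j => hermite R (a i j) * hermite R (b i j)).
  rewrite /hermite_poly /dpoly -big_split; apply: eq_bigr => i _.
  rewrite -big_split; apply: eq_bigr => j _ /=.
  by rewrite rmorphM.
rewrite EnullE.
have [/forallP ab|] := boolP [forall i, forall j, a i j == b i j].
  rewrite mul1r; apply: eq_bigr => i _; apply: eq_bigr => j _.
  by rewrite stdE_hermite (forallP (ab i) j) mul1r.
rewrite negb_forall => /existsP[i]; rewrite negb_forall => /existsP[j abij].
by rewrite mul0r (bigD1 i)//= (bigD1 j)//= stdE_hermite (negbTE abij) !mul0r.
Qed.

Lemma Espiked_hermite rho beta (a : 'I_N -> 'I_n -> nat) : 0 <= beta ->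
  Espiked rho beta (hermite_poly a) =
  \sum_(s : {ffun 'I_n -> option bool}) spike_pmf rho s *
     \prod_i (cmom beta (\sum_j a i j)%N * \prod_j spike_val rho s j 0 ^+ a i j).
Proof.
move=> beta0; have [_ E] := spiked_dpoly rho beta (fun i j => hermite R (a i j)).
apply: (eq_trans E); apply: eq_bigr => s _.
congr (_ * _); apply: eq_bigr => i _; apply: linE_hermite.
exact: cov_factor_spiked.
Qed.

End data_polynomials.

(** * The Hermite expansion and the projected likelihood ratio *)

Section degree.
Variables (R : realType) (N n : nat).
Implicit Types f g : mpoly (N * n) R.

Lemma deg_leC (c : R) : deg_le (N := N) (n := n) 0 (mpolyC _ c).
Proof. by rewrite /deg_le mpoly.msizeC; case: (_ != _). Qed.

Lemma deg_le0 D : deg_le (R := R) (N := N) (n := n) D 0.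
Proof. by rewrite /deg_le msize0. Qed.

Lemma deg_leW D D' f : (D <= D')%N -> deg_le D f -> deg_le D' f.
Proof. by move=> DD' /leq_trans; apply. Qed.

Lemma deg_leD D f g : deg_le D f -> deg_le D g -> deg_le D (f + g).
Proof.
by move=> fD gD; apply: leq_trans (msizeD_le _ _) _; rewrite geq_max; apply/andP.
Qed.

Lemma deg_leZ D c f : deg_le D f -> deg_le D (c *: f).
Proof. by move=> fD; apply: leq_trans (msizeZ_le _ _) _. Qed.

Lemma deg_leB D f g : deg_le D f -> deg_le D g -> deg_le D (f - g).
Proof. by move=> fD gD; rewrite -scaleN1r; apply/deg_leD => //; exact: deg_leZ. Qed.

Lemma deg_le_sum D (I : finType) (P : pred I) (F : I -> mpoly (N * n) R) :
  (forall i, P i -> deg_le D (F i)) -> deg_le D (\sum_(i | P i) F i).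
Proof. by move=> FD; elim/big_ind: _ => //; [exact: deg_le0|move=> *; exact: deg_leD]. Qed.

Lemma deg_leM D D' f g : deg_le D f -> deg_le D' g -> deg_le (D + D') (f * g).
Proof.
move=> fD gD; have [->|fg0] := eqVneq (f * g) 0; first exact: deg_le0.
have [f0|f0] := eqVneq f 0; first by rewrite f0 mul0r eqxx in fg0.
have [g0|g0] := eqVneq g 0; first by rewrite g0 mulr0 eqxx in fg0.
rewrite /deg_le -mlead_deg// ltnS (leq_trans (lemc_mdeg (mleadM_le _ _)))//.
by rewrite mdegD leq_add// -ltnS mlead_deg.
Qed.

Lemma deg_leX k : deg_le 1 (mpolyX R (mnm1 k) : mpoly (N * n) R).
Proof. by rewrite /deg_le msizeX mdeg1. Qed.

Lemma deg_le_hermite k d :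
  deg_le d (horner_alg (mpolyX R (mnm1 k) : mpoly (N * n) R) (hermite R d)).
Proof.
have [m] := ubnP d; elim: m d => // m IH [|d] dm.
  by rewrite rmorph1 -mpolyC1; exact: deg_leC.
rewrite hermiteS rmorphB rmorphM/= horner_algX; apply: deg_leB.
  by rewrite -add1n; apply: deg_leM; [exact: deg_leX|exact: IH].
rewrite deriv_hermite linearZ/= mulr_algl; apply: deg_leZ.
apply: (@deg_leW d.-1); first by rewrite (leq_trans (leq_pred _)).
by apply: IH; rewrite (leq_ltn_trans (leq_pred _)).
Qed.

Lemma deg_le_prod (I : finType) (F : I -> mpoly (N * n) R) (e : I -> nat) :
  (forall i, deg_le (e i) (F i)) -> deg_le (\sum_i e i)%N (\prod_i F i).
Proof.
move=> Fe; elim/big_ind2: _ => //; first by rewrite -mpolyC1; exact: deg_leC.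
by move=> *; exact: deg_leM.
Qed.

Lemma deg_le_hermite_poly (a : 'I_N -> 'I_n -> nat) :
  deg_le (\sum_i \sum_j a i j)%N (hermite_poly R a).
Proof.
by apply: deg_le_prod => i; apply: deg_le_prod => j; exact: deg_le_hermite.
Qed.

(** Multiplication by a variable in the Hermite basis. *)
Lemma mulX_hermite_poly (a : 'I_N -> 'I_n -> nat) i j :
  mpolyX R (mnm1 (mxvec_index i j)) * hermite_poly R a =
  hermite_poly R (fun k l => a k l + ((k == i) && (l == j)))%N +
  (a i j)%:R *: hermite_poly R (fun k l => a k l - ((k == i) && (l == j)))%N.
Proof.
rewrite /hermite_poly /dpoly (bigD1 i)//= [in LHS](bigD1 j)//=.
rewrite [X in _ = X + _](bigD1 i)//= [X in _ = X * _ + _](bigD1 j)//=.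
rewrite [X in _ = _ + _ *: X](bigD1 i)//= [X in _ = _ + _ *: (X * _)](bigD1 j)//=.
rewrite !eqxx/= addn1 subn1.
set X := mpolyX _ _; set V := \prod_(k | k != i) _; set U := \prod_(l | l != j) _.
have -> : \prod_(k | k != i) \prod_l horner_alg (mpolyX R (mnm1 (mxvec_index k l)))
    (hermite R (a k l + ((k == i) && (l == j)))) = V.
  by apply: eq_bigr => k /negbTE ki; apply: eq_bigr => l _; rewrite ki addn0.
have -> : \prod_(k | k != i) \prod_l horner_alg (mpolyX R (mnm1 (mxvec_index k l)))
    (hermite R (a k l - ((k == i) && (l == j)))) = V.
  by apply: eq_bigr => k /negbTE ki; apply: eq_bigr => l _; rewrite ki subn0.
have -> : \prod_(l | l != j) horner_alg (mpolyX R (mnm1 (mxvec_index i l)))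
    (hermite R (a i l + (l == j))) = U.
  by apply: eq_bigr => l /negbTE lj; rewrite lj addn0.
have -> : \prod_(l | l != j) horner_alg (mpolyX R (mnm1 (mxvec_index i l)))
    (hermite R (a i l - (l == j))) = U.
  by apply: eq_bigr => l /negbTE lj; rewrite lj subn0.
rewrite hermiteS rmorphB rmorphM/= horner_algX deriv_hermite linearZ/= mulr_algl.
rewrite !mulrBl -!scalerAl subrK !mulrA.
by [].
Qed.

End degree.

Section hermite_expansion.
Variables (R : realType) (N n D : nat).

Local Notation J := {ffun 'I_N -> {ffun 'I_n -> 'I_D.+1}}.

(** Multi-indices are families [a] of naturals at most [D]; [idx_deg a] is the total
degree and [idx_fact a] the product of the factorials. *)
Definition idx_deg (a : J) : nat := (\sum_i \sum_j a i j)%N.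

Definition idx_fact (a : J) : R := \prod_i \prod_j ((a i j)`!)%:R.

(** The Hermite polynomial of a bounded multi-index. *)
Definition hpoly (a : J) : mpoly (N * n) R := hermite_poly R (fun i j => a i j).

Lemma idx_fact_gt0 a : 0 < idx_fact a.
Proof. by apply: prodr_gt0 => i _; apply: prodr_gt0 => j _; rewrite ltr0n fact_gt0. Qed.

Lemma Enull_hpoly a b : Enull (hpoly a * hpoly b) = (a == b)%:R * idx_fact a.
Proof.
rewrite Enull_hermite; congr (_%:R * _); congr nat_of_bool.
apply/forallP/eqP => [ab|-> i]; last by apply/forallP.
apply/ffunP => i; apply/ffunP => j; apply/val_inj/eqP.
exact: (forallP (ab i)).
Qed.

(** The coefficient of [f] on [hpoly a] in the Hermite basis. *)
Definition hcoef (f : mpoly (N * n) R) a : R := Enull (f * hpoly a) / idx_fact a.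

Lemma hcoef_linear a : linear (hcoef ^~ a).
Proof.
move=> c f g; rewrite /hcoef mulrDl -scalerAl linearD linearZ/=.
by rewrite mulrDl -mulrA.
Qed.

(** The part of degree at most [D] of the Hermite expansion of [f]. *)
Definition hexpand (f : mpoly (N * n) R) := \sum_(a : J | (idx_deg a <= D)%N) hcoef f a *: hpoly a.

Lemma hexpand_linear : linear hexpand.
Proof.
move=> c f g; rewrite /hexpand scaler_sumr -big_split; apply: eq_bigr => a _ /=.
by rewrite scalerA -scalerDl; congr (_ *: _); exact: hcoef_linear.
Qed.

HB.instance Definition _ := GRing.isLinear.Build R (mpoly (N * n) R) (mpoly (N * n) R) _
  hexpand hexpand_linear.

Lemma hexpand_hermite (a : 'I_N -> 'I_n -> nat) : (\sum_i \sum_j a i j <= D)%N ->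
  hexpand (hermite_poly R a) = hermite_poly R a.
Proof.
move=> aD; pose b : J := [ffun i => [ffun j => inord (a i j)]].
have ba i j : b i j = a i j :> nat.
  rewrite !ffunE inordK// ltnS (leq_trans _ aD)// (bigD1 i)//= (bigD1 j)//=.
  by rewrite -addnA leq_addr.
have -> : hermite_poly R a = hpoly b.
  by congr hermite_poly; apply/funext => i; apply/funext => j; rewrite ba.
have bD : (idx_deg b <= D)%N.
  by rewrite /idx_deg; under eq_bigr do under eq_bigr do rewrite ba.
rewrite /hexpand (bigD1 b)//= big1 ?addr0 => [|c /andP[_ cb]].
  by rewrite /hcoef Enull_hpoly eqxx mul1r divff ?scale1r// gt_eqF// idx_fact_gt0.
by rewrite /hcoef Enull_hpoly eq_sym (negbTE cb) mul0r mul0r scale0r.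
Qed.

Lemma hexpand_mon (m : multinom (N * n)) (a : 'I_N -> 'I_n -> nat) :
  (mdeg m + \sum_i \sum_j a i j <= D)%N ->
  hexpand (mpolyX R m * hermite_poly R a) = mpolyX R m * hermite_poly R a.
Proof.
move em : (mdeg m) => k; elim: k m em a => [|k IH] m em a maD.
  move/eqP: em; rewrite mdeg_eq0 => /eqP ->; rewrite mpolyX0 mul1r.
  exact: hexpand_hermite.
have [q mq] : exists q, m q != 0%N.
  apply/existsP; apply: contraT => /existsPn m0.
  move: em; rewrite mdegE big1// => q _; apply/eqP.
  by move: (m0 q); rewrite negbK.
have -> : m = mnm_add (mnm1 q) (mnm_sub m (mnm1 q)).
  apply/mnmP => r; rewrite mnmDE mnmBE mnm1E subnKC//.
  by case: eqVneq => // <-; rewrite lt0n.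
set m' := mnm_sub m (mnm1 q).
have em' : mdeg m' = k.
  move: mq; rewrite -lep1mP => /submK mE.
  by move: em; rewrite -{1}mE mdegD mdeg1 addn1 => -[].
rewrite mpolyXD [mpolyX R (mnm1 q) * _]mulrC -mulrA.
case: q / (mxvec_indexP q) mq m' em' => i j mq m' em'.
rewrite mulX_hermite_poly mulrDr -scalerAr linearD linearZ/=.
have s1 : (\sum_k \sum_l (a k l + ((k == i) && (l == j))) <=
    (\sum_k \sum_l a k l).+1)%N.
  under eq_bigr do rewrite big_split/=.
  rewrite big_split/= -addn1 leq_add2l (bigD1 i)//= (bigD1 j)//= !eqxx/=.
  rewrite big1 => [|l /negbTE lj]; last by rewrite lj.
  by rewrite big1// => r /negbTE ri; rewrite big1// => l _; rewrite ri.
have s2 : (\sum_k \sum_l (a k l - ((k == i) && (l == j))) <= \sum_k \sum_l a k l)%N.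
  by apply: leq_sum => r _; apply: leq_sum => l _; exact: leq_subr.
rewrite !IH//.
- by rewrite (leq_trans _ maD)// addSn -addnS leq_add2l (leq_trans s2).
- by rewrite (leq_trans _ maD)// addSn -addnS leq_add2l.
Qed.

(** The Hermite polynomials of degree at most [D] span the polynomials of degree
at most [D]. *)
Lemma hexpand_id f : deg_le D f -> hexpand f = f.
Proof.
move=> fD; rewrite [in LHS](mpolyE f) [RHS]mpolyE raddf_sum/=.
rewrite big_seq [RHS]big_seq; apply: eq_bigr => m mf.
rewrite linearZ/=; congr (_ *: _).
have h1 : hermite_poly R (fun (i : 'I_N) (j : 'I_n) => 0%N) = 1.
  by rewrite /hermite_poly /dpoly big1// => i _; rewrite big1// => j _; rewrite rmorph1.
rewrite -[mpolyX R m]mulr1 -h1; apply: hexpand_mon.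
rewrite big1 ?addn0 => [|i _]; last by rewrite big1.
by rewrite -ltnS (leq_trans _ fD)// msize_mdeg_lt.
Qed.

Variables (rho beta : R).

(** The projection of the likelihood ratio, in the Hermite basis. *)
Definition hermite_lr : mpoly (N * n) R :=
  \sum_(a : J | (idx_deg a <= D)%N) (Espiked rho beta (hpoly a) / idx_fact a) *: hpoly a.

Lemma deg_hermite_lr : deg_le D hermite_lr.
Proof.
apply: deg_le_sum => a aD; apply: deg_leZ; apply: deg_leW aD _.
exact: deg_le_hermite_poly.
Qed.

Lemma Enull_hermite_lr f : deg_le D f -> Enull (hermite_lr * f) = Espiked rho beta f.
Proof.
move=> fD; rewrite -[in RHS](hexpand_id fD) /hexpand /hermite_lr mulr_suml !raddf_sum/=.
apply: eq_bigr => a _; rewrite -scalerAl !linearZ/= /hcoef [hpoly a * f]mulrC.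
by rewrite /GRing.scale/=; ring.
Qed.

Lemma low_degree_lr_unique : unique (low_degree_lr (n := n) (N := N) rho beta D) hermite_lr.
Proof.
have pM (p f : mpoly (N * n) R) :
    (\int[wishart_null R n N]_y (peval p y * peval f y)%:E = (Enull (p * f))%:E)%E.
  by rewrite -integral_null; under [in RHS]eq_integral do rewrite /peval mevalM.
split.
  split=> [|f fD]; first exact: deg_hermite_lr.
  by rewrite pM integral_spiked Enull_hermite_lr.
move=> p [pD pE]; apply/eqP; rewrite -subr_eq0; apply/eqP.
rewrite -(hexpand_id (deg_leB deg_hermite_lr pD)) /hexpand big1// => a aD.
have haD : deg_le D (hpoly a) by apply: deg_leW aD _; exact: deg_le_hermite_poly.
have := pE _ haD; rewrite pM integral_spiked => -[pa].
by rewrite /hcoef mulrBl raddfB/= pa Enull_hermite_lr// subrr mul0r scale0r.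
Qed.

Lemma Enull_hermite_lr_sqr : Enull (hermite_lr * hermite_lr) =
  \sum_(a : J | (idx_deg a <= D)%N) Espiked rho beta (hpoly a) ^+ 2 / idx_fact a.
Proof.
rewrite Enull_hermite_lr; last exact: deg_hermite_lr.
rewrite [in LHS]/hermite_lr raddf_sum/=; apply: eq_bigr => a _.
by rewrite linearZ/= /GRing.scale/=; ring.
Qed.

Lemma null_norm_hermite_lr :
  null_norm hermite_lr = (Num.sqrt (Enull (hermite_lr * hermite_lr)))%:E.
Proof.
rewrite /null_norm unlock /= (_ : (\int[_]_x _)%E = (Enull (hermite_lr * hermite_lr))%:E).
  rewrite poweR_EFin powR12_sqrt// Enull_hermite_lr_sqr sumr_ge0// => a _.
  by rewrite divr_ge0 ?sqr_ge0// ltW// idx_fact_gt0.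
rewrite -integral_null; apply: eq_integral => y _ /=.
by rewrite /peval mevalM -expr2 powR_mulrn// real_normK// num_real.
Qed.

End hermite_expansion.

(** * Coefficients of powers of generating series *)

Section power_coefficients.
Variable R : realType.

Lemma sum_even_ord (F : nat -> R) k : (forall i, odd i -> F i = 0) ->
  \sum_(i < k.*2.+1) F i = \sum_(i < k.+1) F i.*2.
Proof.
move=> F0; elim: k => [|k IH]; first by rewrite !big_ord_recl !big_ord0.
rewrite big_ord_recr [RHS]big_ord_recr /= -IH doubleS big_ord_recr/=; congr (_ + _).
by rewrite [F k.*2.+1]F0 ?addr0// /= odd_double.
Qed.

(** Sums over families of bounded total degree, read off the coefficients of a
power. *)
Lemma sum_deg_le (K : finType) (W : K -> R) (e : K -> nat) N D :
  \sum_(a : {ffun 'I_N -> K} | (\sum_i e (a i) <= D)%N) \prod_i W (a i) =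
  \sum_(d < D.+1) ((\sum_b W b *: 'X^(e b)) ^+ N)`_d.
Proof.
have -> : (\sum_b W b *: 'X^(e b)) ^+ N = \sum_(a : {ffun 'I_N -> K})
    (\prod_i W (a i)) *: 'X^(\sum_i e (a i))%N.
  rewrite -[N in _ ^+ N]card_ord -prodr_const bigA_distr_bigA/=.
  apply: eq_bigr => a _; rewrite scaler_prod; congr (_ *: _).
  by rewrite -prodrXr.
under [RHS]eq_bigr do rewrite coef_sum.
rewrite [RHS]exchange_big [LHS]big_mkcond; apply: eq_bigr => a _ /=.
under [RHS]eq_bigr do rewrite coefZ coefXn.
case: ifPn => aD.
  have aD' : (\sum_i e (a i) < D.+1)%N by rewrite ltnS.
  rewrite (bigD1 (Ordinal aD'))//= eqxx mulr1 [X in _ + X]big1 ?addr0// => d dn.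
  case: eqP => [ed|]; last by rewrite mulr0.
  by move/eqP: dn; case; apply/val_inj.
rewrite [RHS]big1// => d _; case: eqP => [ed|]; last by rewrite mulr0.
by move: aD; rewrite -ed -ltnS ltn_ord.
Qed.

(** The exponential series of [u], truncated at degree [D]. *)
Definition texp D (u : R) : {poly R} := \poly_(e < D.+1) (u ^+ e / e`!%:R).

Lemma coef_texp D u d : (d <= D)%N -> (texp D u)`_d = u ^+ d / d`!%:R.
Proof. by move=> dD; rewrite coef_poly ltnS dD. Qed.

Lemma coef_prod_texp D n (u : 'I_n -> R) d : (d <= D)%N ->
  (\prod_j texp D (u j))`_d = (\sum_j u j) ^+ d / d`!%:R.
Proof.
elim: n u d => [|n IH] u d dD.
  rewrite !big_ord0 coef1; case: d dD => [|d] _; first by rewrite expr0 divr1.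
  by rewrite expr0n/= mul0r.
rewrite !big_ord_recl coefM exprDn mulr_suml.
rewrite [RHS](reindex_inj rev_ord_inj)/=; apply: eq_bigr => i _.
have id : (i <= d)%N by rewrite -ltnS.
rewrite IH ?(leq_trans (leq_subr _ _))// coef_texp ?(leq_trans id)//.
rewrite subSS subKn// bin_sub// -[X in _ = X / _]mulr_natr -[RHS]mulrA.
have f0 k : (k`!)%:R != 0 :> R by rewrite pnatr_eq0 -lt0n fact_gt0.
have -> : 'C(d, i)%:R / d`!%:R = (i`!%:R)^-1 / (d - i)`!%:R :> R.
  rewrite -(bin_fact id) !natrM; field.
  by rewrite !f0 pnatr_eq0 -lt0n bin_gt0 id.
by rewrite mulrACA.
Qed.

Lemma sum_deg_eq D n (u : 'I_n -> R) d : (d <= D)%N ->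
  \sum_(b : {ffun 'I_n -> 'I_D.+1} | (\sum_j b j == d)%N)
     \prod_j (u j ^+ b j / (b j)`!%:R) = (\sum_j u j) ^+ d / d`!%:R.
Proof.
move=> dD; rewrite -(coef_prod_texp _ dD).
have -> : \prod_j texp D (u j) = \sum_(b : {ffun 'I_n -> 'I_D.+1})
    (\prod_j (u j ^+ b j / (b j)`!%:R)) *: 'X^(\sum_j b j)%N.
  under eq_bigr do rewrite /texp poly_def.
  rewrite bigA_distr_bigA/=; apply: eq_bigr => b _.
  by rewrite scaler_prod -prodrXr.
rewrite coef_sum big_mkcond; apply: eq_bigr => b _.
by rewrite coefZ coefXn eq_sym; case: ifP => _; rewrite ?mulr1 ?mulr0.
Qed.

(** The coefficients of [(1 - z)^(-a)]. *)
Fixpoint rising (a : R) (k : nat) : R :=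
  if k is j.+1 then rising a j * (a + j%:R) / j.+1%:R else 1.

Lemma risingS a k : rising a k.+1 * k.+1%:R = rising a k * (a + k%:R).
Proof. by rewrite /= divfK// pnatr_eq0. Qed.

Lemma rising_ge0 a k : 0 <= a -> 0 <= rising a k.
Proof. by move=> a0; elim: k => //= k IH; rewrite !mulr_ge0// addr_ge0. Qed.

Lemma rising_le a k m : 0 <= a -> (k <= m)%N -> rising a k <= (a + m%:R) ^+ k / k`!%:R.
Proof.
move=> a0; elim: k => [|k IH] km; first by rewrite /= fact0 divr1.
rewrite /= exprSr factS natrM invfM [X in _ <= _ * X]mulrC mulrACA -mulrA.
apply: ler_pM; rewrite ?rising_ge0 ?mulr_ge0 ?addr_ge0 ?invr_ge0 ?IH ?(ltnW km)//.
by rewrite ler_wpM2r ?invr_ge0// lerD2l ler_nat ltnW.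
Qed.

(** The Chu-Vandermonde identity. *)
Lemma rising_vandermonde a b k :
  \sum_(i < k.+1) rising a i * rising b (k - i) = rising (a + b) k.
Proof.
elim: k => [|k IH]; first by rewrite big_ord_recl big_ord0 /= mulr1 addr0.
apply: (@mulIf _ k.+2.-1%:R); first by rewrite pnatr_eq0.
rewrite risingS -IH !mulr_suml.
have -> : \sum_(i < k.+2) rising a i * rising b (k.+1 - i) * k.+1%:R =
  \sum_(i < k.+2) (rising a i * i%:R * rising b (k.+1 - i)) +
  \sum_(i < k.+2) (rising a i * (rising b (k.+1 - i) * (k.+1 - i)%:R)).
  rewrite -big_split; apply: eq_bigr => i _ /=.
  have ik : (i <= k.+1)%N by rewrite -ltnS.
  by rewrite natrB//; ring.
rewrite big_ord_recl mulr0 mul0r add0r [X in _ + X]big_ord_recr/= subnn mulr0 mulr0 addr0.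
rewrite -big_split; apply: eq_bigr => i _ /=.
have ik : (i <= k)%N by rewrite -ltnS.
rewrite /bump add1n risingS subSS subSn// risingS natrB//.
by ring.
Qed.

End power_coefficients.

(** * The norm as a series in the moments of the inner product of two spikes *)

Section norm_formula.
Variables (R : realType) (beta : R).

Lemma cmom_odd d : odd d -> cmom beta d = 0.
Proof.
have [m] := ubnP d; elim: m d => // m IH [|[|d]]//= dm dodd.
by rewrite IH ?mulr0//; [exact: ltnW|move: dodd; rewrite negbK].
Qed.

Lemma cmom_sqr i : cmom beta i.*2 ^+ 2 / (i.*2)`!%:R = beta ^+ i.*2 * rising (1 / 2) i.
Proof.
elim: i => [|i IH]; first by rewrite /= fact0 expr1n divr1 mulr1.
rewrite doubleS cmomSS !exprMn [RHS]/= !factS !natrM.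
have f0 : (i.*2)`!%:R != 0 :> R by rewrite pnatr_eq0 -lt0n fact_gt0.
have -> : cmom beta i.*2 ^+ 2 = (beta ^+ i.*2 * rising (1 / 2) i) * (i.*2)`!%:R.
  by rewrite -IH divfK.
have e1 : i.*2.+1%:R = 2 * i%:R + 1 :> R by rewrite -natr1 -mul2n natrM.
have e2 : i.*2.+2%:R = 2 * i%:R + 2 :> R by rewrite -natr1 e1; ring.
have e3 : i.+1%:R = i%:R + 1 :> R by rewrite natr1.
have p1 : 2 * i%:R + 1 != 0 :> R by rewrite -e1 pnatr_eq0.
have p2 : 2 * i%:R + 2 != 0 :> R by rewrite -e2 pnatr_eq0.
have p3 : i%:R + 1 != 0 :> R by rewrite -e3 pnatr_eq0.
have -> : beta ^+ i.*2.+2 = beta ^+ 2 * beta ^+ i.*2 by rewrite -exprD.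
rewrite e1 e2 e3; field.
by rewrite f0 p1 p2 p3.
Qed.

(** The series [\sum_i cmom i ^ 2 / i! z^i] is [(1 - beta^2 z^2)^(-1/2)]; this is its
[N]-th power, with [T z] in place of [z]. *)
Lemma coef_pow_cmom (P : {poly R}) D N T d : 
  (forall i, (i <= D)%N -> P`_i = cmom beta i ^+ 2 / i`!%:R * T ^+ i) -> (d <= D)%N ->
  (P ^+ N)`_d = T ^+ d * (if odd d then 0 else beta ^+ d * rising (N%:R / 2) d./2).
Proof.
move=> PE; elim: N d => [|N IH] d dD.
  rewrite expr0 coef1; case: d dD => [|d] dD; first by rewrite !mulr1.
  case: ifPn => [|dodd]; first by rewrite mulr0.
  have -> : d.+1./2 = d./2.+1 by rewrite -[in LHS](odd_double_half d); move: dodd; lia.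
  rewrite mul0r (_ : rising (0 : R) _ = 0) ?mulr0//.
  by elim: (d./2) => [|k /= IHk]; rewrite /= ?addr0 ?mulr0 ?mul0r// IHk !mul0r.
rewrite exprS coefM.
transitivity (T ^+ d * \sum_(i < d.+1) (cmom beta i ^+ 2 / i`!%:R *
    (if odd (d - i) then 0 else beta ^+ (d - i) * rising (N%:R / 2) (d - i)./2))).
  rewrite mulr_sumr; apply: eq_bigr => i _.
  have id : (i <= d)%N by rewrite -ltnS.
  rewrite PE ?(leq_trans id)// IH ?(leq_trans (leq_subr _ _))//.
  by rewrite [LHS]mulrA -[X in X * _ = _]mulrA -exprD subnKC// -mulrA mulrCA.
congr (_ * _); case: ifPn => dodd.
  rewrite big1// => i _; have id : (i <= d)%N by rewrite -ltnS.
  have [iodd|ieven] := boolP (odd i); first by rewrite cmom_odd// expr0n mul0r mul0r.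
  by rewrite oddB// dodd (negbTE ieven)/= mulr0.
have dE : d = d./2.*2 by rewrite -[LHS]odd_double_half (negbTE dodd).
pose F i := cmom beta i ^+ 2 / i`!%:R *
  (if odd (d - i) then 0 else beta ^+ (d - i) * rising (N%:R / 2) (d - i)./2).
have F0 i : odd i -> F i = 0 by move=> iodd; rewrite /F cmom_odd// expr0n !mul0r.
have := sum_even_ord d./2 F0; rewrite -dE => SE; rewrite [LHS]SE /F.
have -> : N.+1%:R / 2 = 1 / 2 + N%:R / 2 :> R by rewrite -natr1; field.
rewrite -rising_vandermonde mulr_sumr; apply: eq_bigr => i _.
have id : (i <= d./2)%N by rewrite -ltnS.
have -> : (d - i.*2 = (d./2 - i).*2)%N by rewrite doubleB -dE.
rewrite odd_double doubleK cmom_sqr mulrACA -exprD.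
by congr (_ ^+ _ * _); rewrite -doubleD subnKC// -dE.
Qed.

Variables (rho : R) (N n D : nat).

(** The inner product of the spikes coded by [s] and [t], and its moments when they
are drawn independently from the prior. *)
Definition spike_inner (s t : {ffun 'I_n -> option bool}) : R :=
  \sum_j spike_val rho s j 0 * spike_val rho t j 0.

Definition inner_moment (d : nat) : R :=
  \sum_s \sum_t spike_pmf rho s * spike_pmf rho t * spike_inner s t ^+ d.

(** The squared norm of the projected likelihood ratio. *)
Lemma norm_formula : 0 <= beta ->
  Enull (hermite_lr N n D rho beta * hermite_lr N n D rho beta) =
  \sum_(d < D.+1) (if odd d then 0 else beta ^+ d * rising (N%:R / 2) d./2) * inner_moment d.
Proof.
move=> beta0; rewrite Enull_hermite_lr_sqr.
pose W s t (b : {ffun 'I_n -> 'I_D.+1}) : R := cmom beta (\sum_j b j)%N ^+ 2 *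
  \prod_j ((spike_val rho s j 0 * spike_val rho t j 0) ^+ b j / (b j)`!%:R).
have E (a : {ffun 'I_N -> {ffun 'I_n -> 'I_D.+1}}) :
    Espiked rho beta (hpoly R a) ^+ 2 / idx_fact R a =
    \sum_s \sum_t spike_pmf rho s * spike_pmf rho t * \prod_i W s t (a i).
  rewrite /hpoly Espiked_hermite// expr2 mulr_suml mulr_suml; apply: eq_bigr => s _.
  rewrite mulr_sumr mulr_suml; apply: eq_bigr => t _.
  rewrite mulrACA -[LHS]mulrA; congr (_ * _).
  rewrite -big_split /idx_fact -prodfV -big_split; apply: eq_bigr => i _ /=.
  rewrite mulrACA -expr2 -[LHS]mulrA; congr (_ * _).
  rewrite -big_split -prodfV -big_split; apply: eq_bigr => j _ /=.
  by rewrite exprMn.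
under eq_bigr do rewrite E.
rewrite exchange_big/=.
under eq_bigr do rewrite exchange_big/=.
under [RHS]eq_bigr do rewrite /inner_moment mulr_sumr.
rewrite [RHS]exchange_big/=; apply: eq_bigr => s _.
under [RHS]eq_bigr do rewrite mulr_sumr.
rewrite [RHS]exchange_big/=; apply: eq_bigr => t _.
rewrite -mulr_sumr (sum_deg_le (W s t) (fun b => (\sum_j b j)%N)) mulr_sumr.
apply: eq_bigr => d _; rewrite (@coef_pow_cmom _ D N (spike_inner s t)); last first.
- by rewrite -ltnS.
- move=> i iD; rewrite coef_sum.
  under eq_bigr do rewrite coefZ coefXn.
  rewrite (bigID (fun b : {ffun 'I_n -> 'I_D.+1} => (\sum_j b j == i)%N))/=.
  rewrite [X in _ + X]big1 ?addr0 => [|b]; last first.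
    by rewrite eq_sym => /negbTE->; rewrite mulr0.
  rewrite mulrAC -[RHS]mulrA -(sum_deg_eq _ iD) mulr_sumr; apply: eq_bigr => b /eqP bi.
  by rewrite bi eqxx mulr1 /W bi.
by rewrite [LHS]mulrA [LHS]mulrC.
Qed.

End norm_formula.

(** * Bounds on the moments of the inner product *)

Section moment_bound.
Variable R : realType.

(** The bound on the coefficient of degree [k] of the [p]-th power of the series
[1 + rho^2 \sum_(j >= 1) u^j / (2j)!], with [m = p rho^2]. *)
Definition mbound (k : nat) (m : R) : R := (m + k%:R / 6) ^+ k / (2 ^+ k * k`!%:R).

Lemma mbound_ge0 k m : 0 <= m -> 0 <= mbound k m.
Proof. by move=> m0; rewrite /mbound divr_ge0 ?mulr_ge0 ?exprn_ge0 ?addr_ge0 ?divr_ge0. Qed.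

Lemma fact_even_ge i : (2 * 12 ^ i * i`! <= (i.*2.+2)`!)%N.
Proof.
elim: i => // i IH.
rewrite expnS [i.+1`!]factS doubleS 2!factS; nia.
Qed.

(** The increment of [mbound] in [m] dominates the convolution of [mbound] with the
Taylor coefficients of [cosh - 1]. *)
Lemma mbound_step k m r : 0 <= m -> 0 <= r ->
  mbound k m + r * \sum_(i < k) mbound (k - i.+1) m / (i.*2.+2)`!%:R <= mbound k (m + r).
Proof.
move=> m0 r0; case: k => [|k].
  by rewrite big_ord0 mulr0 addr0 /mbound !expr0.
have f0 j : 0 < j`!%:R :> R by rewrite ltr0n fact_gt0.
(* [mbound k.+1] has slope [z ^+ k / (2 ^+ k.+1 * k`!)] at [m]: [S] compares the sum to
   this slope, [B] is convexity. *)
pose z := m + k.+1%:R / 6.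
have z0 : 0 <= z by rewrite addr_ge0 ?divr_ge0.
have S : \sum_(i < k.+1) mbound (k.+1 - i.+1) m / (i.*2.+2)`!%:R <=
    z ^+ k / (2 ^+ k.+1 * k`!%:R).
  have -> : z = (m + k%:R / 6) + 1 / 6 by rewrite /z -natr1; field.
  rewrite exprDn mulr_suml; apply: ler_sum => i _.
  have ik : (i <= k)%N by rewrite -ltnS.
  rewrite subSS -[_ *+ 'C(_, _)]mulr_natr /mbound.
  have -> : 'C(k, i)%:R = k`!%:R / (i`!%:R * (k - i)`!%:R) :> R.
    rewrite -(bin_fact ik) !natrM mulfK// mulf_neq0// gt_eqF//.
  have h1 : (m + (k - i)%:R / 6) ^+ (k - i) <= (m + k%:R / 6) ^+ (k - i).
    rewrite lerXn2r ?nnegrE ?addr_ge0 ?divr_ge0// lerD2l ler_wpM2r// ler_nat.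
    exact: leq_subr.
  have h2 : (i.*2.+2)`!%:R^-1 <= (2 * 12 ^+ i * i`!%:R)^-1 :> R.
    rewrite lef_pV2 ?posrE ?mulr_gt0 ?exprn_gt0//.
    by rewrite -natrX -!natrM ler_nat fact_even_ge.
  have h3 : (2 ^+ (k - i) * (k - i)`!%:R)^-1 * (2 * 12 ^+ i * i`!%:R)^-1 =
      (1 / 6) ^+ i * (k`!%:R / (i`!%:R * (k - i)`!%:R)) / (2 ^+ k.+1 * k`!%:R) :> R.
    have -> : 12 ^+ i = 2 ^+ i * 6 ^+ i :> R by rewrite -exprMn -natrM.
    have -> : 2 ^+ k.+1 = 2 * 2 ^+ i * 2 ^+ (k - i) :> R.
      by rewrite -mulrA -exprD subnKC// exprS.
    rewrite expr_div_n expr1n; field.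
    by rewrite !gt_eqF ?exprn_gt0//.
  rewrite -mulrA -[leRHS]mulrA -[X in _ <= X]mulrA.
  rewrite [X in _ <= _ * X]mulrA -h3.
  apply: ler_pM => //.
  - by rewrite exprn_ge0// addr_ge0 ?divr_ge0.
  by rewrite ler_wpM2l// invr_ge0 mulr_ge0// exprn_ge0.
have B : z ^+ k.+1 + k.+1%:R * r * z ^+ k <= (z + r) ^+ k.+1.
  rewrite [leRHS]exprDn big_ord_recl big_ord_recl /= subn0 expr0 mulr1 bin0 mulr1n.
  rewrite (_ : bump 0 0 = 1%N)// subSS subn0 expr1 bin1 addrA.
  rewrite -[z ^+ k * r *+ _]mulr_natl [z ^+ k * r]mulrC mulrA lerDl sumr_ge0// => i _.
  by rewrite mulrn_wge0// mulr_ge0// exprn_ge0.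
apply: (le_trans (lerD (lexx _) (ler_wpM2l r0 S))).
rewrite /mbound -/z addrAC -/z.
apply: (le_trans _ (ler_wpM2r _ B)); last by rewrite invr_ge0 mulr_ge0// exprn_ge0.
rewrite factS natrM le_eqVlt; apply/orP; left; apply/eqP; field.
by rewrite !gt_eqF ?exprn_gt0.
Qed.

End moment_bound.

Section inner_moments.
Variables (R : realType) (rho : R) (n : nat).
Hypothesis rho01 : 0 < rho <= 1.

(** The truncated exponential generating series of the moments of the product of two
independent entries of the spike. *)
Definition entry_series (D : nat) : {poly R} :=
  \sum_(e : option bool) \sum_(f : option bool)
    (entry_pmf rho e * entry_pmf rho f) *: texp D (entry_val rho n e * entry_val rho n f).

Lemma inner_moment_coef d :
  inner_moment rho n d = d`!%:R * (entry_series d ^+ n)`_d.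
Proof.
have -> : entry_series d ^+ n =
    \sum_(s : {ffun 'I_n -> option bool}) \sum_(t : {ffun 'I_n -> option bool})
      (spike_pmf rho s * spike_pmf rho t) *:
      \prod_j texp d (spike_val rho s j 0 * spike_val rho t j 0).
  rewrite -[n in _ ^+ n]card_ord -prodr_const bigA_distr_bigA/=.
  apply: eq_bigr => s _; rewrite bigA_distr_bigA/=; apply: eq_bigr => t _.
  rewrite /spike_pmf -big_split -scaler_prod/=; apply: eq_bigr => j _.
  by rewrite !mxE.
rewrite coef_sum mulr_sumr; apply: eq_bigr => s _.
rewrite coef_sum mulr_sumr; apply: eq_bigr => t _.
rewrite coefZ coef_prod_texp// mulrCA; congr (_ * _).
by rewrite mulrC divfK// pnatr_eq0 -lt0n fact_gt0.
Qed.

Lemma entry_valM b c :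
  entry_val rho n (Some b) * entry_val rho n (Some c) = (-1) ^+ (b (+) c) / (rho * n%:R).
Proof.
rewrite /entry_val mulrACA signr_addb -invfM -expr2 sqr_sqrtr//.
by case/andP: rho01 => r0 _; rewrite mulr_ge0// ltW.
Qed.

Lemma coef_entry_series D i : (i <= D)%N -> (entry_series D)`_i =
  if i == 0%N then 1 else if odd i then 0 else rho ^+ 2 * (rho * n%:R)^-1 ^+ i / i`!%:R.
Proof.
move=> iD; rewrite coef_sum.
under eq_bigr do (rewrite coef_sum; under eq_bigr do rewrite coefZ coef_texp//).
have so (F : option bool -> R) : \sum_e F e = F None + (F (Some true) + F (Some false)).
  rewrite (bigD1 None)//= (bigD1 (Some true))//= (bigD1 (Some false))//= big1 ?addr0//.
  by case=> [[]|].
rewrite !so !entry_valM /=; set c := (rho * n%:R)^-1.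
rewrite !mul0r !mulr0 /entry_pmf; case/andP: rho01 => /ltW -> ->/=.
case: i iD => [|i] iD /=.
  by rewrite !expr0 fact0; field.
rewrite !expr0n /= !mul0r !mulr0 expr1 expr0 mul1r mulN1r.
have -> : (- c) ^+ i.+1 = (-1) ^+ (~~ odd i) * c ^+ i.+1.
  by rewrite [LHS]exprNn -[in LHS]signr_odd.
have f0 : (i.+1)`!%:R != 0 :> R by rewrite pnatr_eq0 -lt0n fact_gt0.
by case: (odd i); rewrite /= ?expr0 ?expr1; field.
Qed.

End inner_moments.

(** * The bound on the norm *)

Section norm_bound.
Variables (R : realType) (rho : R) (n : nat).
Hypothesis rho01 : 0 < rho <= 1.

(** By induction on the exponent, with [mbound_step]. *)
Lemma coef_pow_entry_le D p k : (k.*2 <= D)%N ->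
  0 <= (entry_series rho n D ^+ p)`_(k.*2) <=
    (rho * n%:R)^-1 ^+ k.*2 * mbound k (p%:R * rho ^+ 2).
Proof.
set c := (rho * n%:R)^-1.
have c0 : 0 <= c by case/andP: rho01 => /ltW r0 _; rewrite invr_ge0 mulr_ge0.
elim: p k => [|p IH] k kD.
  rewrite expr0 coef1 mul0r double_eq0.
  case: k kD => [|k] kD; first by rewrite /mbound !expr0 fact0 !mul1r invr1 ler01 lexx.
  by rewrite lexx/= mulr_ge0 ?exprn_ge0 ?mbound_ge0.
have E : (entry_series rho n D ^+ p.+1)`_(k.*2) = (entry_series rho n D ^+ p)`_(k.*2) +
    \sum_(i < k) rho ^+ 2 * c ^+ i.*2.+2 / (i.*2.+2)`!%:R *
       (entry_series rho n D ^+ p)`_((k - i.+1).*2).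
  rewrite exprS coefM.
  rewrite (sum_even_ord (F := fun i => (entry_series rho n D)`_i *
      (entry_series rho n D ^+ p)`_(k.*2 - i)) k); last first.
    move=> i iodd; have [iD|Di] := leqP i D.
      by rewrite coef_entry_series// iodd; case: eqP iodd => [->|_ _]//; rewrite mul0r.
    rewrite [X in X * _](_ : _ = 0) ?mul0r//.
    rewrite coef_sum big1// => e _; rewrite coef_sum big1// => f _.
    by rewrite coefZ coef_poly ltnNge Di mulr0.
  rewrite big_ord_recl subn0 coef_entry_series// eqxx mul1r; congr (_ + _).
  apply: eq_bigr => i _ /=; rewrite /bump add1n doubleS.
  have ik : (i.*2.+2 <= D)%N by rewrite -doubleS (leq_trans _ kD)// leq_double.
  by rewrite coef_entry_series// /= odd_double -doubleS doubleB.
have kiD (i : 'I_k) : ((k - i.+1).*2 <= D)%N.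
  by rewrite (leq_trans _ kD)// leq_double leq_subr.
have w0 (i : 'I_k) : 0 <= rho ^+ 2 * c ^+ i.*2.+2 / (i.*2.+2)`!%:R.
  by rewrite mulr_ge0 ?invr_ge0// mulr_ge0 ?sqr_ge0// exprn_ge0.
rewrite E; apply/andP; split.
  rewrite addr_ge0//; first by case/andP: (IH _ kD).
  by apply: sumr_ge0 => i _; rewrite mulr_ge0//; case/andP: (IH _ (kiD i)).
have m0 : 0 <= p%:R * rho ^+ 2 by rewrite mulr_ge0// sqr_ge0.
have := mbound_step k m0 (sqr_ge0 rho).
rewrite -[X in mbound k (_ + X)]mul1r -mulrDl natr1.
move=> /(ler_wpM2l (exprn_ge0 k.*2 c0)); apply: le_trans.
rewrite mulrDr lerD//; first by case/andP: (IH _ kD).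
rewrite !mulr_sumr ler_sum// => i _.
have /andP[_ h] := IH _ (kiD i).
apply: (le_trans (ler_wpM2l (w0 i) h)).
have -> : c ^+ k.*2 = c ^+ i.*2.+2 * c ^+ (k - i.+1).*2.
  by rewrite -exprD -doubleS -doubleD subnKC.
rewrite le_eqVlt; apply/orP; left; apply/eqP; ring.
Qed.

Lemma inner_moment_le k :
  0 <= inner_moment rho n k.*2 <=
  (k.*2)`!%:R * ((rho * n%:R)^-1 ^+ k.*2 * mbound k (n%:R * rho ^+ 2)).
Proof.
rewrite inner_moment_coef//; have /andP[h1 h2] := coef_pow_entry_le n (leqnn k.*2).
by rewrite mulr_ge0//= ler_wpM2l.
Qed.

Lemma fact_double_le k : ((k.*2)`! <= 4 ^ k * k`! ^ 2)%N.
Proof.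
elim: k => // k IH; rewrite doubleS 2!factS expnS [k.+1`!]factS.
set f := k`! in IH *; set g := (k.*2)`! in IH *; set h := (4 ^ k)%N in IH *.
nia.
Qed.

Variables (beta : R) (N D : nat).
Hypothesis beta0 : 0 <= beta.

(** The ratio of the geometric series that dominates the squared norm. *)
Definition growth_ratio : R :=
  beta ^+ 2 * (N%:R + D%:R) * (n%:R * rho ^+ 2 + D%:R / 12) * (rho * n%:R)^-1 ^+ 2.

Lemma norm_term_le k : (k.*2 <= D)%N ->
  beta ^+ k.*2 * rising (N%:R / 2) k * inner_moment rho n k.*2 <= growth_ratio ^+ k.
Proof.
move=> kD; have /andP[M0 M1] := inner_moment_le k.
set c := (rho * n%:R)^-1 in M1 *.
have kD2 : k%:R * 2 <= D%:R :> R by rewrite -natrM muln2 ler_nat.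
have f0 j : 0 < j`!%:R :> R by rewrite ltr0n fact_gt0.
have R1 : rising (N%:R / 2) k <= ((N%:R + D%:R) / 2) ^+ k / k`!%:R :> R.
  have N2 : 0 <= N%:R / 2 :> R by rewrite divr_ge0.
  apply: (le_trans (rising_le N2 (leqnn k))).
  rewrite ler_wpM2r ?invr_ge0// lerXn2r ?nnegrE ?divr_ge0 ?addr_ge0 ?divr_ge0//.
  have N0 : 0 <= N%:R :> R by []. lra.
have m0 : 0 <= n%:R * rho ^+ 2 by rewrite mulr_ge0// sqr_ge0.
have B1 : mbound k (n%:R * rho ^+ 2) <= (n%:R * rho ^+ 2 + D%:R / 12) ^+ k / (2 ^+ k * k`!%:R).
  rewrite /mbound ler_wpM2r ?invr_ge0 ?mulr_ge0 ?exprn_ge0//.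
  rewrite lerXn2r ?nnegrE ?(addr_ge0 m0) ?divr_ge0// lerD2l; lra.
have F1 : (k.*2)`!%:R <= 4 ^+ k * k`!%:R ^+ 2 :> R.
  by rewrite -!natrX -natrM ler_nat fact_double_le.
have c20 : 0 <= c ^+ k.*2 by rewrite -muln2 exprM sqr_ge0.
have b20 : 0 <= beta ^+ k.*2 by rewrite exprn_ge0.
have M2 : inner_moment rho n k.*2 <= 4 ^+ k * k`!%:R ^+ 2 *
    (c ^+ k.*2 * ((n%:R * rho ^+ 2 + D%:R / 12) ^+ k / (2 ^+ k * k`!%:R))).
  apply: (le_trans M1); apply: ler_pM => //.
    by rewrite mulr_ge0 ?mbound_ge0.
  by rewrite ler_wpM2l.
apply: (@le_trans _ _ (beta ^+ k.*2 * (((N%:R + D%:R) / 2) ^+ k / k`!%:R) *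
   (4 ^+ k * k`!%:R ^+ 2 * (c ^+ k.*2 *
    ((n%:R * rho ^+ 2 + D%:R / 12) ^+ k / (2 ^+ k * k`!%:R)))))).
  apply: ler_pM => //; first by rewrite mulr_ge0// rising_ge0// divr_ge0.
  by rewrite ler_wpM2l.
rewrite le_eqVlt; apply/orP; left; apply/eqP.
have e2 (x : R) : x ^+ k.*2 = (x ^+ 2) ^+ k by rewrite -exprM mul2n.
rewrite /growth_ratio -/c !e2; set b2 := beta ^+ 2; set c2 := c ^+ 2; set M := _ + D%:R / 12.
rewrite [RHS]exprMn (exprMn k (b2 * _) M) (exprMn k b2) (exprMn k (N%:R + D%:R)) exprVn.
have -> : 4 ^+ k = 2 ^+ k * 2 ^+ k :> R by rewrite -exprMn -natrM.
have t0 : 2 ^+ k != 0 :> R by rewrite gt_eqF// exprn_gt0.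
field.
by rewrite t0 gt_eqF.
Qed.

Lemma Enull_hermite_lr_le r : 0 <= r -> r < 1 -> growth_ratio <= r ->
  Enull (hermite_lr N n D rho beta * hermite_lr N n D rho beta) <= (1 - r)^-1.
Proof.
move=> r0 r1 rr; rewrite norm_formula//.
have ratio0 : 0 <= growth_ratio.
  rewrite /growth_ratio; apply: mulr_ge0; last exact: sqr_ge0.
  apply: mulr_ge0; first by apply: mulr_ge0; rewrite ?sqr_ge0// addr_ge0.
  by apply: addr_ge0; [apply: mulr_ge0; rewrite ?sqr_ge0|rewrite divr_ge0].
(* Extending the range to an even bound lets the sum be indexed by [d / 2]. *)
apply: (@le_trans _ _ (\sum_(d < D.*2.+1)
    (if odd d then 0 else r ^+ d./2))).
  rewrite [leRHS](_ : _ = \sum_(d < D.+1) (if odd d then 0 else r ^+ d./2) +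
     \sum_(D.+1 <= d < D.*2.+1) (if odd d then 0 else r ^+ d./2)); last first.
    rewrite -!(big_mkord xpredT (fun d => if odd d then 0 else r ^+ d./2)).
    by rewrite -big_cat_nat// ltnS -addnn leq_addr.
  rewrite -[leLHS]addr0 lerD//; last first.
    by apply: sumr_ge0 => d _; case: ifP => // _; rewrite exprn_ge0.
  apply: ler_sum => d _; case: ifPn => dodd; first by rewrite mul0r.
  have dE : d = d./2.*2 :> nat by rewrite -[LHS]odd_double_half (negbTE dodd).
  rewrite {1 3}dE; apply: (le_trans (@norm_term_le d./2 _)).
    by rewrite -dE -ltnS.
  by rewrite lerXn2r.
rewrite (sum_even_ord (F := fun d => if odd d then 0 else r ^+ d./2)); last first.
  by move=> i ->.
under eq_bigr do rewrite odd_double doubleK.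
have r1' : 0 < 1 - r by rewrite subr_gt0.
rewrite -(ler_pM2l r1') mulfV ?gt_eqF//.
have -> : (1 - r) * \sum_(i < D.+1) r ^+ i = 1 - r ^+ D.+1.
  by rewrite -opprB mulNr -subrX1 opprB.
by rewrite gerBl exprn_ge0.
Qed.

End norm_bound.

(** * Asymptotics *)

Lemma limn_esup_lt_near (R : realType) (u : nat -> R) (x : R) :
  (limn_esup (fun n => (u n)%:E) < x%:E)%E ->
  exists2 l, l < x & \forall n \near \oo, u n <= l.
Proof.
move=> /ereal_inf_lt[_ [V FV <-] Vx].
have near_le (l : R) : (ereal_sup [set (u n)%:E | n in V] <= l%:E)%E ->
    \forall n \near \oo, u n <= l.
  move=> sl; apply: filterS FV => n Vn; rewrite -lee_fin (le_trans _ sl)//.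
  by apply: ereal_sup_ubound; exists n.
case: (ereal_sup _) Vx near_le => [s| |]//.
- by rewrite lte_fin => sx /(_ s (lexx _)); exists s.
- by move=> _ /(_ (x - 1) (leNye _)); exists (x - 1) => //; rewrite ltrBlDr ltrDl.
Qed.

Section ratio.
Variable R : realType.

Lemma ratio_le (rho beta lam q : R) (n N D : nat) : (0 < n)%N -> (0 < N)%N ->
  0 < rho -> beta ^+ 2 = lam ^+ 2 * (n%:R / N%:R) ->
  lam ^+ 2 * (1 + D%:R / (12 * (n%:R * rho ^+ 2))) <= q -> 0 <= q < 1 ->
  D%:R / N%:R <= (1 - q) / 2 -> growth_ratio rho n beta N D <= (1 + q) / 2.
Proof.
move=> n0 N0 rho0 b2 hq /andP[q0 q1] hD.
have nR : n%:R != 0 :> R by rewrite pnatr_eq0 -lt0n.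
have NR : N%:R != 0 :> R by rewrite pnatr_eq0 -lt0n.
have -> : growth_ratio rho n beta N D =
    (1 + D%:R / N%:R) * (lam ^+ 2 * (1 + D%:R / (12 * (n%:R * rho ^+ 2)))).
  by rewrite /growth_ratio b2; field; rewrite nR NR gt_eqF.
apply: (@le_trans _ _ ((1 + (1 - q) / 2) * q)).
  apply: ler_pM => //.
  - by rewrite mulr_ge0 ?sqr_ge0// addr_ge0// divr_ge0// !mulr_ge0// ltW.
  by rewrite lerD2l.
nra.
Qed.

(** Only the bound [ln (1 / lam) <= 1 / lam - 1] is used on the logarithm. *)
Lemma sparsity_log (rho lam l : R) (n D : nat) : (0 < n)%N -> 0 < lam -> lam <= l ->
  l < 1 -> 0 < rho ->
  Num.max 1 (Num.sqrt (1 / (6 * ln (1 / lam)))) * Num.sqrt (D%:R / n%:R) <= rho ->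
  lam ^+ 2 * (1 + D%:R / (12 * (n%:R * rho ^+ 2))) <= l.
Proof.
move=> n0 lam0 laml l1 rho0 h.
have lam1 : lam < 1 by exact: le_lt_trans l1.
have nR : 0 < n%:R :> R by rewrite ltr0n.
have y0 : 0 < 1 / lam by rewrite divr_gt0.
have L0 : 0 < ln (1 / lam) by rewrite ln_gt0// ltr_pdivlMr// mul1r.
have L1 : ln (1 / lam) <= 1 / lam - 1.
  by have := expR_ge1Dx (ln (1 / lam)); rewrite lnK ?posrE//; lra.
set L := ln (1 / lam) in h L0 L1.
have h2 : 1 / (6 * L) * (D%:R / n%:R) <= rho ^+ 2.
  have a0 : 0 <= 1 / (6 * L) by rewrite divr_ge0// mulr_ge0// ltW.
  have b0 : 0 <= D%:R / n%:R :> R by rewrite divr_ge0.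
  rewrite -[X in X * _](sqr_sqrtr a0) -[X in _ * X](sqr_sqrtr b0) -exprMn.
  rewrite lerXn2r ?nnegrE ?mulr_ge0 ?sqrtr_ge0 ?(ltW rho0)//.
  by apply: le_trans h; rewrite ler_wpM2r ?sqrtr_ge0// le_max lexx orbT.
have h3 : D%:R / (12 * (n%:R * rho ^+ 2)) <= L / 2.
  have r2 : 0 < rho ^+ 2 by rewrite exprn_gt0.
  rewrite ler_pdivrMr ?mulr_gt0//.
  have -> : L / 2 * (12 * (n%:R * rho ^+ 2)) = 6 * L * n%:R * rho ^+ 2 by field.
  rewrite -ler_pdivrMl ?mulr_gt0//; apply: le_trans h2.
  rewrite le_eqVlt; apply/orP; left; apply/eqP; field.
  by rewrite !gt_eqF.
apply: (@le_trans _ _ (lam ^+ 2 * (1 + (1 / lam - 1) / 2))).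
  by rewrite ler_wpM2l ?sqr_ge0// lerD2l (le_trans h3)// ler_wpM2r.
have -> : lam ^+ 2 * (1 + (1 / lam - 1) / 2) = (lam ^+ 2 + lam) / 2.
  by field; rewrite gt_eqF.
nra.
Qed.

(** The value 5 / 12 is the bound 1 / 3 on [lam ^+ 2] plus 1 / 12. *)
Lemma sparsity_linear (rho lam : R) (n D : nat) : (0 < n)%N -> 0 < lam ->
  lam <= 1 / Num.sqrt 3 -> 0 < rho -> lam * Num.sqrt (D%:R / n%:R) <= rho ->
  lam ^+ 2 * (1 + D%:R / (12 * (n%:R * rho ^+ 2))) <= 5 / 12.
Proof.
move=> n0 lam0 laml rho0 h.
have nR : 0 < n%:R :> R by rewrite ltr0n.
have l2 : lam ^+ 2 <= 1 / 3.
  have -> : 1 / 3 = (1 / Num.sqrt 3) ^+ 2 :> R by rewrite expr_div_n expr1n sqr_sqrtr.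
  by rewrite lerXn2r ?nnegrE ?divr_ge0 ?sqrtr_ge0// ltW.
have h2 : lam ^+ 2 * D%:R <= n%:R * rho ^+ 2.
  have b0 : 0 <= D%:R / n%:R :> R by rewrite divr_ge0.
  have : (lam * Num.sqrt (D%:R / n%:R)) ^+ 2 <= rho ^+ 2.
    by rewrite lerXn2r ?nnegrE ?mulr_ge0 ?sqrtr_ge0 ?(ltW rho0) ?(ltW lam0).
  by rewrite exprMn sqr_sqrtr// mulrA ler_pdivrMr// [X in _ <= X]mulrC.
have r2 : 0 < n%:R * rho ^+ 2 by rewrite mulr_gt0// exprn_gt0.
rewrite mulrDr mulr1 mulrA.
have : lam ^+ 2 * D%:R / (12 * (n%:R * rho ^+ 2)) <= 1 / 12.
  rewrite ler_pdivrMr ?mulr_gt0//; lra.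
lra.
Qed.

End ratio.

Theorem theorem2p14 (R : realType) (D N : nat -> nat) (rho beta : nat -> R)
  (gamma lambda : nat -> R) (gamma_lim : R)
  (hrho : forall n, 0 < rho n <= 1)
  (hbeta : forall n, 0 < beta n)
  (hgamma : forall n, gamma n = n%:R / (N n)%:R)
  (hgamma_lim : 0 < gamma_lim)
  (hgamma_cvg : gamma n @[n --> \oo] --> gamma_lim)
  (hlambda : forall n, lambda n = beta n / Num.sqrt (gamma n))
  (hD : (fun n => (D n)%:R : R) =o_\oo (fun n => n%:R : R))
  (hab :
    ((limn_esup (fun n => (lambda n)%:E) < 1%:E)%E /\
     \forall n \near \oo,
       Num.max 1 (Num.sqrt (1 / (6 * ln (1 / lambda n))))
         * Num.sqrt ((D n)%:R / n%:R) <= rho n) \/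
    ((limn_esup (fun n => (lambda n)%:E) < (1 / Num.sqrt 3)%:E)%E /\
     \forall n \near \oo,
       lambda n * Num.sqrt ((D n)%:R / n%:R) <= rho n)) :
  exists L : forall n, mpoly.mpoly (N n * n) R,
    (forall n, unique (low_degree_lr (rho n) (beta n) (D n)) (L n)) /\
    exists C : R, \forall n \near \oo, (null_norm (L n) <= C%:E)%E.
Proof.
exists (fun n => hermite_lr (N n) n (D n) (rho n) (beta n)); split.
  by move=> n; exact: low_degree_lr_unique.
have gamma_gt0 : \forall n \near \oo, 0 < gamma n.
  exact: (cvgr_gt _ hgamma_cvg).
have gamma_le : \forall n \near \oo, gamma n <= gamma_lim + 1.
  by apply: (cvgr_le _ hgamma_cvg); rewrite ltrDl.
have rho_gt0 n : 0 < rho n by case/andP: (hrho n).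
have lambda_gt0 n : 0 < gamma n -> 0 < lambda n.
  by move=> g0; rewrite hlambda divr_gt0// sqrtr_gt0.
have [q q01 hq] : exists2 q : R, 0 <= q < 1 & \forall n \near \oo,
    lambda n ^+ 2 * (1 + (D n)%:R / (12 * (n%:R * rho n ^+ 2))) <= q.
  case: hab => -[/limn_esup_lt_near[l l1 hl] hsp].
    exists (Num.max 0 l); first by rewrite le_max lexx gt_max ltr01.
    near=> n; rewrite le_max; apply/orP; right.
    have g0 : 0 < gamma n by near: n.
    apply: (@sparsity_log _ _ _ l) => //.
    - by near: n; exact: nbhs_infty_gt.
    - exact: lambda_gt0.
    - by near: n.
    - by near: n.
  exists (5 / 12); first by apply/andP; split; lra.
  near=> n; have g0 : 0 < gamma n by near: n.
  apply: sparsity_linear => //.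
  - by near: n; exact: nbhs_infty_gt.
  - exact: lambda_gt0.
  - by apply: le_trans (ltW l1); near: n.
  - by near: n.
pose r := (1 + q) / 2.
have [q0 q1] := andP q01.
have r01 : 0 <= r < 1 by apply/andP; split; rewrite /r; lra.
exists (Num.sqrt ((1 - r)^-1)).
have e0 : 0 < (1 - q) / 2 / (gamma_lim + 1) :> R.
  by rewrite !divr_gt0// ?subr_gt0// addr_gt0.
have {}hD := (eqoP _ _ _).1 hD _ e0.
near=> n; rewrite null_norm_hermite_lr lee_fin ler_sqrt; last first.
  by rewrite invr_ge0 subr_ge0 ltW; case/andP: r01.
have [r0 r1] := andP r01.
apply: Enull_hermite_lr_le => //; first exact: ltW.
have n0 : (0 < n)%N by near: n; exact: nbhs_infty_gt.
have g0 : 0 < gamma n by near: n.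
have N0 : (0 < N n)%N.
  by rewrite lt0n; apply/eqP => N0; move: g0; rewrite hgamma N0 invr0 mulr0 ltxx.
apply: (@ratio_le _ _ _ (lambda n)) => //.
- rewrite hlambda expr_div_n sqr_sqrtr ?(ltW g0)// -hgamma divfK// gt_eqF//.
- by near: n.
have nR : 0 < n%:R :> R by rewrite ltr0n.
have Dn : (D n)%:R / n%:R <= (1 - q) / 2 / (gamma_lim + 1).
  rewrite ler_pdivrMr//.
  have : `|(D n)%:R : R| <= (1 - q) / 2 / (gamma_lim + 1) * `|n%:R : R| by near: n.
  by rewrite !ger0_norm.
have -> : (D n)%:R / (N n)%:R = (D n)%:R / n%:R * gamma n.
  by rewrite hgamma mulrA divfK// gt_eqF.
apply: (@le_trans _ _ ((1 - q) / 2 / (gamma_lim + 1) * (gamma_lim + 1))).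
  apply: ler_pM => //; first exact: ltW.
  by near: n.
by rewrite divfK// gt_eqF// addr_gt0.
Unshelve. all: by end_near. Qed.
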